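(* Let $F$ and $\tilde F$ be continuous distribution functions of positive random variables with finite means $\overline{\tau}$ and $\tilde{\overline{\tau}}$ and infinite variances, i.e. $\int_0^\infty 2s(1-F(s))\,ds=\int_0^\infty 2s(1-\tilde F(s))\,ds=\infty$. Let $M_{eq}$ and $\tilde M_{eq}$ be the equilibrium mean square displacements associated with $F$ and $\tilde F$ respectively (with the same velocity distribution, $E[|V_i|^2]=v^2$). Assume $1-F(t)\sim1-\tilde F(t)$ as $t\to\infty$. Then $$\overline{\tau}\,M_{eq}(t)\sim\tilde{\overline{\tau}}\,\tilde M_{eq}(t)\quad\text{as }t\to\infty.$$
   Context: Equilibrium mean square displacement associated with $F$: let $\overline{\tau}=\int_0^\infty(1-F(s))\,ds$, let $\tau_1,\tau_2,\dots$ be i.i.d. with distribution $F$, let $T_0$ be independent of the $\tau_i$ with distribution function $F_0(t)=\frac1{\overline{\tau}}\int_0^t(1-F(s))\,ds$, and $T_i=T_{i-1}+\tau_i$. Let $V_0,V_1,\dots$ be i.i.d. random vectors in $\mathbb{R}^d$, independent of the times, with $E[V_i]=0$ and $E[|V_i|^2]=v^2\in(0,\infty)$. Set $V(t)=V_0$ for $0\le t<T_0$, $V(t)=V_i$ for $T_{i-1}\le t<T_i$, $X(t)=\int_0^tV(s)\,ds$, and $M_{eq}(t)=E[|X(t)|^2]$. $\tilde M_{eq}$ is defined in the same way from $\tilde F$. *)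

(* Defs.v *)
From HB Require Import structures.
From mathcomp Require Import all_boot all_order all_algebra.
From mathcomp Require Import all_classical all_reals all_analysis.
Set Implicit Arguments. Unset Strict Implicit. Unset Printing Implicit Defensive.
Import Order.TTheory GRing.Theory Num.Theory.
Import numFieldNormedType.Exports.
Local Open Scope classical_set_scope.
Local Open Scope ring_scope.

Section Defs.
Context {R : realType}.

Definition taubar (F : R -> R) : R :=
  fine (\int[lebesgue_measure]_(s in `[0%R, +oo[) (1 - F s)%:E)%E.

Definition F0 (F : R -> R) (t : R) : R :=
  (taubar F)^-1 * Rintegral lebesgue_measure `[0%R, t] (fun s => 1 - F s).

Context {d0 : measure_display} {Omega : measurableType d0}.

Definition sigma_RV (X : Omega -> R) : set (set Omega) :=
  <<s preimage_set_system setT X measurable >>.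
Definition sigma_RVvec (dim : nat) (X : 'I_dim -> Omega -> R) : set (set Omega) :=
  <<s \bigcup_(k in setT) preimage_set_system setT (X k) measurable >>.

Definition mutually_independent (P : probability Omega R) (I : eqType)
  (G : I -> set (set Omega)) : Prop :=
  forall (s : seq I) (A : I -> set Omega), uniq s ->
    (forall i, i \in s -> G i (A i)) ->
    P (\big[setI/setT]_(i <- s) A i) = (\prod_(i <- s) P (A i))%E.

Fixpoint Tn (T0 : Omega -> R) (tau : nat -> Omega -> R) (i : nat) (w : Omega) : R :=
  if i is j.+1 then Tn T0 tau j w + tau j.+1 w else T0 w.

Definition Tlo (T0 : Omega -> R) (tau : nat -> Omega -> R) (i : nat) (w : Omega) : R :=
  if i is j.+1 then Tn T0 tau j w else 0.

Definition vel (dim : nat) (T0 : Omega -> R) (tau : nat -> Omega -> R)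
  (V : nat -> 'I_dim -> Omega -> R) (s : R) (w : Omega) (k : 'I_dim) : R :=
  match pselect (exists i, Tlo T0 tau i w <= s < Tn T0 tau i w) with
  | left H => V (projT1 (cid H)) k w
  | right _ => 0
  end.

Definition Xpos (dim : nat) (T0 : Omega -> R) (tau : nat -> Omega -> R)
  (V : nat -> 'I_dim -> Omega -> R) (t : R) (w : Omega) (k : 'I_dim) : R :=
  Rintegral lebesgue_measure `[0%R, t] (fun s => vel T0 tau V s w k).

(* M_eq(t) = E |X(t)|^2 (finite since |X(t)| <= ... ; taken as a real) *)
Definition Meq (P : probability Omega R) (dim : nat) (T0 : Omega -> R)
  (tau : nat -> Omega -> R) (V : nat -> 'I_dim -> Omega -> R) (t : R) : R :=
  fine (\int[P]_w (\sum_(k < dim) (Xpos T0 tau V t w k) ^+ 2)%:E)%E.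

Definition eq_setup (P : probability Omega R) (dim : nat) (F : R -> R)
  (T0 : Omega -> R) (tau : nat -> Omega -> R) (V : nat -> 'I_dim -> Omega -> R)
  (v : R) : Prop :=
  measurable_fun setT T0 /\
      (forall i, measurable_fun setT (tau i)) /\
      (forall i k, measurable_fun setT (V i k)) /\
      mutually_independent P
        (fun j : nat + nat => match j with
                   | inl 0 => sigma_RV T0
                   | inl i => sigma_RV (tau i)
                   | inr i => sigma_RVvec (V i) end) /\
      (forall x, P [set w | T0 w <= x] = (F0 F x)%:E) /\
      (forall i x, (0 < i)%N -> P [set w | tau i w <= x] = (F x)%:E) /\
      (forall i (B : 'I_dim -> set R), (forall k, measurable (B k)) ->
         P (\big[setI/setT]_(k < dim) (V i k @^-1` B k)) =
         P (\big[setI/setT]_(k < dim) (V 0%N k @^-1` B k))) /\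
      (forall k, P.-integrable setT (EFin \o V 0%N k) /\
                 (\int[P]_w (V 0%N k w)%:E = 0)%E) /\
      (\int[P]_w (\sum_(k < dim) (V 0%N k w) ^+ 2)%:E = (v ^+ 2)%:E)%E.

End Defs.

(* Main.v *)
Require Import Defs.
From HB Require Import structures.
From mathcomp Require Import all_boot all_order all_algebra.
From mathcomp Require Import all_classical all_reals all_analysis.
From mathcomp Require Import measurable_realfun simple_functions.
From mathcomp Require Import ring lra.
Import Order.TTheory GRing.Theory Num.Theory.
Import numFieldNormedType.Exports.
Local Open Scope classical_set_scope.
Local Open Scope ring_scope.
Set Implicit Arguments. Unset Strict Implicit. Unset Printing Implicit Defensive.

(** Let L_i be the length of the part of [0, t] spent with velocity V_i.
    Independence and centering of the velocities give
    M_eq(t) = v^2 * sum_i E[L_i^2]. The layer cake formula turns E[L_i^2] into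
    the integral over y in [0, t] of 2 y P(duration_i > y) P(start_i <= t - y),
    and in equilibrium the renewal measure sum_i P(T_i <= x) is x / taubar, so
    taubar * M_eq(t) / v^2 is the integral over y in [0, t] of
    2 y (G(y) + (t - y) (1 - F(y))), with G(y) the integral of 1 - F over
    [y, +oo[. This functional N(t) is linear and monotone in 1 - F: altering
    1 - F on a bounded set moves N(t) by O(1 + t), whereas the infinite
    variance makes N(t) / t tend to infinity, so N only sees the tail of F. *)

Section null_sets.
Local Open Scope ereal_scope.
Context (d : measure_display) (T : measurableType d) (R : realType).
Variable mu : {measure set T -> \bar R}.
Import HBNNSimple.

(* [f] may fail to be measurable off [G]: [Xpos] selects an index by choice on
   degenerate paths, so it is only measurable up to a null set. *)
Lemma ge0_integral_conull (G : set T) (f : T -> \bar R) :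
  measurable G -> mu (~` G) = 0 -> measurable_fun G f ->
  (forall x, 0 <= f x) ->
  \int[mu]_x f x = \int[mu]_(x in G) f x.
Proof.
move=> mG G0 mf f0.
have mN : measurable (~` G) by exact: measurableC.
have mfG : measurable_fun setT (f \_ G) by exact/(measurable_restrictT _ _).1.
have fG0 x : 0 <= (f \_ G) x by apply: erestrict_ge0.
rewrite [RHS]integral_mkcond.
apply/eqP; rewrite eq_le; apply/andP; split.
- rewrite ge0_integralTE//; apply: ge_ereal_sup => _ /= [h hf <-].
  rewrite -integralT_nnsfun; apply: ae_ge0_le_integral => //.
  + by move=> x _; rewrite lee_fin.
  + exact/measurable_EFinP.
  + exists (~` G); split => //= x /=; apply: contra_not => Gx _.
    by rewrite patchE mem_set.
- rewrite !ge0_integralTE//; apply: ereal_sup_le => _ /= [h hf <-].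
  exists h => //= x; apply: le_trans (hf x) _.
  by rewrite patchE; case: ifP.
Qed.

Lemma ge0_integral_eq_conull (G : set T) (f g : T -> \bar R) :
  measurable G -> mu (~` G) = 0 -> measurable_fun setT g ->
  (forall x, 0 <= f x) -> (forall x, 0 <= g x) -> {in G, f =1 g} ->
  \int[mu]_x f x = \int[mu]_x g x.
Proof.
move=> mG G0 mg f0 g0 fg.
have mgG : measurable_fun G g by exact: measurable_funTS.
have mfG : measurable_fun G f.
  by apply: eq_measurable_fun mgG => x xG; exact/esym/fg.
by rewrite (ge0_integral_conull mG)// (ge0_integral_conull mG G0 mgG)//; exact: eq_integral.
Qed.

End null_sets.

(** * Independence *)

Section pair_law.
Local Open Scope ereal_scope.
Context (d : measure_display) (T : measurableType d) (R : realType).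
Variable P : probability T R.

Definition indep_pair (f g : T -> R) := forall A B, measurable A -> measurable B ->
  P (f @^-1` A `&` g @^-1` B) = P (f @^-1` A) * P (g @^-1` B).

Variables f g : T -> R.
Hypotheses (mf : measurable_fun setT f) (mg : measurable_fun setT g).
Hypothesis fg : indep_pair f g.

Lemma indep_pair_integral (h : R * R -> \bar R) : measurable_fun setT h ->
  (forall x, 0 <= h x) ->
  \int[P]_w h (f w, g w) = \int[P]_w \int[P]_w' h (f w', g w).
Proof.
move=> mh h0.
pose f' : {RV P >-> R} := mfun_Sub (mem_set mf).
pose g' : {RV P >-> R} := mfun_Sub (mem_set mg).
have mfg : measurable_fun setT (fun w => (f w, g w)) by exact: measurable_fun_pair.
pose k' : {RV P >-> (R * R)%type} := mfun_Sub (mem_set mfg).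
have E : forall X, measurable X ->
    (distribution P f' \x distribution P g') X = distribution P k' X.
  by apply: product_measure_unique => A B mA mB; exact: fg.
transitivity (\int[distribution P k']_z h z).
  by rewrite ge0_integral_distribution.
transitivity (\int[distribution P f' \x distribution P g']_z h z).
  by apply: eq_measure_integral => A mA _; exact/esym/E.
rewrite fubini_tonelli2// ge0_integral_distribution; last 2 first.
- exact: measurable_fun_fubini_tonelli_G.
- by move=> y; apply: integral_ge0.
apply: eq_integral => w _ /=; rewrite /fubini_G ge0_integral_distribution//.
exact: measurableT_comp.
Qed.

Lemma indep_pair_comp (u v : R -> R) : measurable_fun setT u ->
  measurable_fun setT v -> indep_pair (u \o f) (v \o g).
Proof.
move=> mu mv A B mA mB.
have mA' : measurable (u @^-1` A) by rewrite -[X in measurable X]setTI; exact: mu.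
have mB' : measurable (v @^-1` B) by rewrite -[X in measurable X]setTI; exact: mv.
exact: fg mA' mB'.
Qed.

End pair_law.

Section pair_expectation.
Local Open Scope ereal_scope.
Context (d : measure_display) (T : measurableType d) (R : realType).
Variable P : probability T R.
Implicit Types f g : T -> R.

Lemma indep_ge0_integralM f g : measurable_fun setT f -> measurable_fun setT g ->
  indep_pair P f g -> (forall w, 0 <= f w)%R -> (forall w, 0 <= g w)%R ->
  \int[P]_w (f w * g w)%:E = \int[P]_w (f w)%:E * \int[P]_w (g w)%:E.
Proof.
move=> mf mg fg f0 g0.
have mf' : measurable_fun setT (EFin \o f) by exact/measurable_EFinP.
have mg' : measurable_fun setT (EFin \o g) by exact/measurable_EFinP.
transitivity (\int[P]_w (`|f w * g w|)%:E).
  by apply: eq_integral => w _; rewrite ger0_norm// mulr_ge0.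
rewrite (indep_pair_integral mf mg fg (h := fun z => `|z.1 * z.2|%:E))//=.
  rewrite -ge0_integralZl//; last 2 first.
  - by move=> w _; rewrite lee_fin.
  - by apply: integral_ge0 => w _; rewrite lee_fin.
  apply: eq_integral => w _ /=.
  rewrite -ge0_integralZr//; last 2 first.
  - by move=> w' _; rewrite lee_fin.
  - by rewrite lee_fin.
  by apply: eq_integral => w' _; rewrite ger0_norm ?mulr_ge0.
apply/measurable_EFinP; apply: measurableT_comp => //.
exact: measurable_funM.
Qed.

Lemma indep_integrableM f g :
  indep_pair P f g -> P.-integrable setT (EFin \o f) ->
  P.-integrable setT (EFin \o g) ->
  P.-integrable setT (fun w => (f w * g w)%:E).
Proof.
move=> fg /[dup] /integrableP[/measurable_EFinP mf fi] _.
move=> /[dup] /integrableP[/measurable_EFinP mg gi] _.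
apply/integrableP; split; first exact/measurable_EFinP/measurable_funM.
under eq_integral do rewrite /= normrM.
rewrite (@indep_ge0_integralM (Num.norm \o f) (Num.norm \o g))//.
- have n0 (k : T -> R) : 0 <= \int[P]_w ((Num.norm \o k) w)%:E.
    by apply: integral_ge0 => w _; rewrite lee_fin /=.
  by rewrite lte_mul_pinfty// ge0_fin_numE.
- exact: measurableT_comp.
- exact: measurableT_comp.
- exact: (indep_pair_comp fg (@normr_measurable R setT) (@normr_measurable R setT)).
- by move=> w /=.
- by move=> w /=.
Qed.

Lemma indep_integralM0 f g :
  indep_pair P f g -> P.-integrable setT (EFin \o f) ->
  P.-integrable setT (EFin \o g) -> \int[P]_w (f w)%:E = 0 ->
  \int[P]_w (f w * g w)%:E = 0.
Proof.
move=> fg fi gi f0.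
have [/measurable_EFinP mf _] := integrableP _ _ _ fi.
have [/measurable_EFinP mg _] := integrableP _ _ _ gi.
have mh : measurable_fun setT (fun z : R * R => (z.1 * z.2)%:E).
  exact/measurable_EFinP/measurable_funM.
pose f' : {RV P >-> R} := mfun_Sub (mem_set mf).
pose g' : {RV P >-> R} := mfun_Sub (mem_set mg).
have mfg : measurable_fun setT (fun w => (f w, g w)) by exact: measurable_fun_pair.
pose k' : {RV P >-> (R * R)%type} := mfun_Sub (mem_set mfg).
have E : forall X, measurable X ->
    (distribution P f' \x distribution P g') X = distribution P k' X.
  by apply: product_measure_unique => A B mA mB; exact: fg.
have ik : (distribution P k').-integrable setT (fun z : R * R => (z.1 * z.2)%:E).
  by apply: integrable_pushforward => //; exact: indep_integrableM.
transitivity (\int[distribution P k']_z (z.1 * z.2)%:E).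
  by rewrite integral_distribution//; exact: indep_integrableM.
transitivity (\int[distribution P f' \x distribution P g']_z (z.1 * z.2)%:E).
  by apply: eq_measure_integral => A mA _; exact/esym/E.
rewrite -integral21_prod_meas1; last first.
  apply/integrableP; split => //.
  rewrite (@eq_measure_integral _ _ _ _ (distribution P k')); last first.
    by move=> A mA _; exact: E.
  by case/integrableP: ik.
rewrite integral0_eq// => y _; rewrite /fubini_G/= integral_distribution/=.
- under eq_integral do rewrite /= EFinM.
  by rewrite integralZr// f0 mul0e.
- exact/measurable_EFinP/measurable_funM.
- under eq_fun do rewrite /= EFinM.
  exact: integrableZr.
Qed.

End pair_expectation.

Section independence.
Local Open Scope ereal_scope.
Context (R : realType) (d : measure_display) (T : measurableType d).
Variables (P : probability T R) (I : eqType) (G : I -> set (set T)).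
Hypothesis GS : forall i, sigma_algebra setT (G i).
Hypothesis Gm : forall i, G i `<=` measurable.
Hypothesis Gind : mutually_independent P G.

Definition family_but (i0 : I) : set (set T) := \bigcup_(j in [set j | j != i0]) G j.

Let GT i : G i setT.
Proof. by have /sigma_algebraP[//|] := GS i. Qed.

Let GI i : setI_closed (G i).
Proof.
move=> A B; rewrite -(sigma_algebra_id (GS i)).
exact: (@measurableI _ (g_sigma_algebraType (G i))).
Qed.

Let bigcap_seqE (s : seq I) (A : I -> set T) :
  \bigcap_(i in [set` s]) A i = \big[setI/setT]_(i <- s) A i.
Proof.
elim: s => [|i s IH]; first by rewrite big_nil; apply/seteqP; split => x.
rewrite big_cons -IH; apply/seteqP; split => x /=.
  move=> h; split; first by apply: h; rewrite /= mem_head.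
  by move=> j js; apply: h; rewrite /= in_cons js orbT.
by move=> [xi h] j; rewrite /= in_cons => /predU1P[->//|]; exact: h.
Qed.

Lemma indep_family_but (i0 : I) (A B : set T) : G i0 A -> <<s family_but i0 >> B ->
  P (A `&` B) = P A * P B.
Proof.
move=> GA.
pose C : set (set T) := [set B | exists s (A' : I -> set T),
  [/\ uniq s, i0 \notin s, (forall i, i \in s -> G i (A' i)) &
      B = \bigcap_(i in [set` s]) A' i]].
have CI : setI_closed C.
  move=> _ _ [s1 [A1 [u1 n1 g1 ->]]] [s2 [A2 [u2 n2 g2 ->]]].
  exists (undup (s1 ++ s2)), (fun i => (if i \in s1 then A1 i else setT) `&`
     (if i \in s2 then A2 i else setT)); split.
  - exact: undup_uniq.
  - by rewrite mem_undup mem_cat negb_or n1 n2.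
  - by move=> i _; apply: GI; case: ifPn => // ?; [exact: g1|exact: g2].
  - apply/seteqP; split => x /=.
      move=> [x1 x2] i /=; rewrite mem_undup mem_cat => _.
      by split; case: ifPn => // ?; [exact: x1|exact: x2].
    move=> h; split => i /= si.
      by have := h i; rewrite /= mem_undup mem_cat si => /(_ isT)[].
    by have := h i; rewrite /= mem_undup mem_cat si orbT => /(_ isT)[].
have sub : <<s family_but i0 >> `<=` <<s C >>.
  apply: smallest_sub; first exact: smallest_sigma_algebra.
  move=> E [j /= ji GE]; apply: sub_sigma_algebra.
  exists [:: j], (fun=> E); split => //.
  - by rewrite inE eq_sym.
  - by move=> i; rewrite inE => /eqP ->.
  - apply/seteqP; split => x /=; first by move=> Ex i.
    by apply; rewrite /= inE.
move=> /sub sB.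
have mA : measurable A := Gm GA.
suff : <<s C >> `<=` [set E | measurable E /\ P (A `&` E) = P A * P E].
  by move=> /(_ _ sB)[].
apply: (lambda_system_subset CI) => //.
- apply/dynkin_lambda_system; split => /=.
  + by split; rewrite ?setIT ?probability_setT ?mule1.
  + move=> E [mE PE]; split; first exact: measurableC.
    rewrite -setDE measureD//; last first.
      by rewrite (le_lt_trans (probability_le1 _ _))// ltry.
    rewrite [X in P A - X](_ : _ = P A * P E); last exact: PE.
    rewrite [P (~` E)](_ : _ = 1 - P E); last exact: probability_setC.
    by rewrite muleBr ?mule1// ?fin_num_adde_defr ?fin_num_measure.
  + move=> F tF FP.
    have mF k : measurable (F k) by case: (FP k).
    have mU : measurable (\bigcup_k F k) by exact: bigcup_measurable.
    split => //; rewrite setI_bigcupr measure_semi_bigcup//.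
    * rewrite (eq_eseriesr (g := fun k => P A * P (F k))); last first.
        by move=> k _; exact: (FP k).2.
      rewrite measure_semi_bigcup// -[P A]fineK ?fin_num_measure//.
      by rewrite nneseriesZl.
    * by move=> k; exact: measurableI.
    * exact: trivIset_setIl.
    * by rewrite -setI_bigcupr; exact: measurableI.
- move=> _ [s [A' [us ns gs ->]]].
  have mA' i : i \in s -> measurable (A' i) by move=> /gs; exact: Gm.
  split.
    by rewrite bigcap_seqE big_seq; apply: bigsetI_measurable.
  have := @Gind (i0 :: s) (fun i => if i == i0 then A else A' i).
  rewrite /= ns us !big_cons eqxx => /(_ isT) H.
  have eqs (X : Type) (op : X -> X -> X) (e : X) (h : set T -> X) :
      \big[op/e]_(i <- s) h (if i == i0 then A else A' i) = \big[op/e]_(i <- s) h (A' i).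
    rewrite big_seq [RHS]big_seq; apply: eq_bigr => i si.
    by case: eqP => // ii0; move: ns; rewrite -ii0 si.
  move: H; rewrite (eqs _ _ _ id) (eqs _ _ _ P) => H.
  rewrite bigcap_seqE H.
    congr (_ * _).
    have := @Gind s A' us gs; by move=> ->.
  move=> i; rewrite inE => /orP[/eqP ->|si]; first by rewrite eqxx.
  by case: eqP => [->//|_]; exact: gs.
Qed.

Lemma indep_pair_family_but (i0 : I) (f g : T -> R) :
  (forall A, measurable A -> G i0 (f @^-1` A)) ->
  measurable_fun [set: g_sigma_algebraType (family_but i0)] g -> indep_pair P f g.
Proof.
move=> Gf mg A B mA mB; apply: (@indep_family_but i0); first exact: Gf.
by have := mg measurableT _ mB; rewrite setTI.
Qed.

Lemma family_but_measurable (i0 : I) (g : T -> R) :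
  measurable_fun [set: g_sigma_algebraType (family_but i0)] g -> measurable_fun [set: T] g.
Proof.
move=> mg _ B mB; have := mg measurableT _ mB.
have : <<s family_but i0 >> `<=` measurable.
  apply: smallest_sub; first exact: sigma_algebra_measurable.
  by move=> E [j _]; exact: Gm.
by apply.
Qed.

Lemma measurable_family_but (i0 j : I) (g : T -> R) : j != i0 ->
  (forall A, measurable A -> G j (g @^-1` A)) ->
  measurable_fun [set: g_sigma_algebraType (family_but i0)] g.
Proof.
move=> ji Gg _ B mB; rewrite setTI.
by apply: sub_sigma_algebra; exists j => //; exact: Gg.
Qed.

End independence.

(** * The renewal functional and its asymptotics *)

Section layer_integrals.
Context (R : realType).
Local Notation mu := (@lebesgue_measure R).

Lemma integral_double_id (b : R) : 0 <= b ->
  (\int[mu]_(y in `[0%R, b]) (2 * y)%:E = (b ^+ 2)%:E)%E.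
Proof.
rewrite le_eqVlt => /predU1P[<-|b0].
  by rewrite set_itv1 integral_set1 expr0n.
rewrite (@continuous_FTC2 R (fun y => 2 * y) (fun y => y ^+ 2))//.
- by rewrite expr0n/= sube0.
- by apply: continuous_subspaceT; exact: mulrl_continuous.
- split.
  + by move=> x _; exact: exprn_derivable.
  + by apply: cvg_at_right_filter; exact: exprn_continuous.
  + by apply: cvg_at_left_filter; exact: exprn_continuous.
- by move=> x _; rewrite exp_derive1 expr1 -mulr_natl mulr1.
Qed.

Lemma measurable_bool_natmul (d : measure_display) (T : measurableType d)
    (D : set T) (b : T -> bool) :
  measurable_fun D b -> measurable_fun D ((fun x => (b x)%:R) : T -> R).
Proof. exact: (@measurableT_comp _ _ _ _ _ _ ((fun c => c%:R) : bool -> R)). Qed.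

Lemma integral_layer_sqr (t a b : R) : 0 <= t ->
  (\int[mu]_(y in `[0%R, t]) (2 * y * ((y < a) && (b <= t - y))%R%:R)%:E =
   (Num.max 0 (Num.min t (Num.min a (t - b))) ^+ 2)%:E)%E.
Proof.
move=> t0; set L := Num.max _ _.
have L0 : 0 <= L by rewrite le_max lexx.
have m2 (D : set R) : measurable_fun D (fun y : R => 2 * y).
  exact: measurable_funM.
have -> : (\int[mu]_(y in `[0%R, t]) (2 * y * ((y < a) && (b <= t - y))%R%:R)%:E =
  \int[mu]_(y in `[0%R, L[) (2 * y)%:E)%E.
  rewrite [LHS]integral_mkcond [RHS]integral_mkcond.
  apply: ae_eq_integral => //.
  - apply/(measurable_restrictT _ _).1 => //; apply/measurable_EFinP.
    apply: measurable_funM; first exact: m2.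
    apply: measurable_bool_natmul; apply: measurable_and.
      exact: measurable_fun_ltr.
    by apply: measurable_fun_ler => //; exact: measurable_funB.
  - by apply/(measurable_restrictT _ _).1 => //; apply/measurable_EFinP; exact: m2.
  - exists [set L]; split => //.
      exact: lebesgue_measure_set1.
    move=> y /=; apply: contra_notP => /eqP yL _.
    rewrite !patchE !mem_setE !in_itv/=.
    have [y0|//] := leP 0 y; rewrite /=.
    suff -> : (y < L) = [&& y <= t, y < a & b <= t - y].
      by case: (y <= t) => //=; case: (_ && _); rewrite ?mulr1 ?mulr0.
    rewrite lt_neqAle yL/=; apply/idP/idP.
      move=> yL'; have := yL; have : y < L by rewrite lt_neqAle yL.
      rewrite lt_max ltNge y0/= !lt_min => /and3P[yt -> yb] _.
      by rewrite ltW//= lerBrDl addrC -lerBrDl ltW.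
    move=> /and3P[yt ya yb].
    by rewrite le_max !le_min yt (ltW ya) lerBrDl addrC -lerBrDl yb orbT.
rewrite integral_itv_bndo_bndc; last by apply/measurable_EFinP; exact: m2.
by rewrite integral_double_id.
Qed.

Lemma integral_layer_pospart (x a : R) : 0 <= a ->
  (\int[mu]_(u in `[0%R, x]) ((a <= u)%R%:R)%:E = (Num.max 0 (x - a))%:E)%E.
Proof.
move=> a0.
transitivity (\int[mu]_(u in `[0%R, x]) (\1_(`[a, +oo[%classic) u)%:E)%E.
  by apply: eq_integral => u _; rewrite indicE mem_setE in_itv/= andbT.
rewrite integral_indic//.
rewrite (_ : _ `&` _ = `[a, x]%classic); last first.
  apply/seteqP; split => u /=; rewrite !in_itv/= ?andbT.
    by move=> [-> /andP[_ ->]].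
  by move=> /andP[au ->]; rewrite au (le_trans a0 au).
rewrite [LHS](lebesgue_measure_itv `[a, x])/= lte_fin.
have [ax|xa] := ltP a x; first by rewrite max_r// subr_ge0 ltW.
by rewrite max_l// subr_le0.
Qed.

End layer_integrals.

Section tails.
Context (R : realType).
Local Notation mu := (@lebesgue_measure R).
Implicit Types f g : R -> R.

Definition tail f (y : R) : R := fine (\int[mu]_(s in `[y, +oo[) (f s)%:E)%E.

Definition msd_dens f (t y : R) : R := 2 * y * (tail f y + (t - y) * f y).

(* For [f = 1 - F], this is [taubar F * M_eq(t) / v ^+ 2]. *)
Definition msd f (t : R) : \bar R := (\int[mu]_(y in `[0%R, t]) (msd_dens f t y)%:E)%E.

Definition survival f := [/\ measurable_fun setT f, (forall x, 0 <= f x <= 1) &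
  (\int[mu]_(s in `[0%R, +oo[) (f s)%:E < +oo)%E].

Section one_tail.
Variable f : R -> R.
Hypothesis Sf : survival f.

Let mf : measurable_fun setT f. Proof. by case: Sf. Qed.
Let f0 x : 0 <= f x. Proof. by case: Sf => _ /(_ x)/andP[]. Qed.
Let f1 x : f x <= 1. Proof. by case: Sf => _ /(_ x)/andP[]. Qed.
Let mfE (D : set R) : measurable_fun D (EFin \o f).
Proof. by apply/measurable_EFinP; apply: measurable_funTS. Qed.

Lemma tail_fin (y : R) : 0 <= y -> (\int[mu]_(s in `[y, +oo[) (f s)%:E)%E = (tail f y)%:E.
Proof.
move=> y0; rewrite fineK// ge0_fin_numE; last first.
  by apply: integral_ge0 => s _; rewrite lee_fin.
case: Sf => _ _; apply: le_lt_trans; apply: ge0_subset_integral => //=.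
- exact: mfE.
- by move=> s _; rewrite lee_fin.
- by move=> s /=; rewrite !in_itv/= !andbT; apply: le_trans.
Qed.

Lemma tail_ge0 y : 0 <= tail f y.
Proof. by apply: fine_ge0; apply: integral_ge0 => s _; rewrite lee_fin. Qed.

Lemma tail_le (x y : R) : 0 <= x -> x <= y -> tail f y <= tail f x.
Proof.
move=> x0 xy; rewrite -lee_fin -!tail_fin//; last exact: le_trans xy.
apply: ge0_subset_integral => //=.
- exact: mfE.
- by move=> s _; rewrite lee_fin.
- by move=> s /=; rewrite !in_itv/= !andbT; apply: le_trans.
Qed.

Lemma tail_split (y : R) : 0 <= y ->
  (tail f 0)%:E = (\int[mu]_(s in `[0%R, y]) (f s)%:E + (tail f y)%:E)%E.
Proof.
move=> y0; rewrite -!tail_fin//.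
rewrite -integral_itv_bndo_bndc// -ge0_integral_setU//=.
- congr (integral _ _ _); apply/seteqP; split => s /=; rewrite !in_itv/= !andbT.
    by move=> s0; case: (ltP s y) => sy; [left; rewrite s0|right].
  by move=> [/andP[]//|]; exact: le_trans.
- exact: mfE.
- by move=> s _; rewrite lee_fin.
- apply/disj_setPS => s /= []; rewrite !in_itv/= andbT => /andP[_ sy] ys.
  by move: (lt_le_trans sy ys); rewrite ltxx.
Qed.

Lemma measurable_tail (t : R) : measurable_fun (`[0%R, t] : set R) (tail f).
Proof.
have mm : measurable_fun setT (fun y : R => tail f (Num.max 0 y)).
  apply: nonincreasing_measurable => // x y xy; apply: tail_le.
    by rewrite le_max lexx.
  by rewrite ge_max !le_max lexx xy orbT.
apply: (eq_measurable_fun (fun y : R => tail f (Num.max 0 y))).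
  by move=> y; rewrite inE/= in_itv/= => /andP[y0 _]; rewrite max_r.
exact: measurable_funTS.
Qed.

Lemma measurable_msd_dens (t : R) : measurable_fun (`[0%R, t] : set R) (msd_dens f t).
Proof.
apply: measurable_funM.
  exact: measurable_funM.
apply: measurable_funD; first exact: measurable_tail.
apply: measurable_funM; last exact: measurable_funTS.
exact: measurable_funB.
Qed.

Lemma msd_dens_ge0 t y : y \in `[0, t] -> 0 <= msd_dens f t y.
Proof.
rewrite in_itv/= => /andP[y0 yt].
by rewrite mulr_ge0 ?mulr_ge0// addr_ge0 ?tail_ge0// mulr_ge0// subr_ge0.
Qed.

Lemma msd_dens_le s t y : y \in `[0, t] -> y <= s ->
  msd_dens f t y <= 2 * s * (tail f 0 + t).
Proof.
rewrite in_itv/= => /andP[y0 yt] ys.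
have t0 := le_trans y0 yt.
apply: ler_pM; rewrite ?mulr_ge0 ?addr_ge0 ?tail_ge0 ?mulr_ge0 ?subr_ge0//.
  by rewrite ler_pM2l.
apply: lerD; first exact: tail_le.
rewrite -[leRHS]mulr1; apply: ler_pM; rewrite ?subr_ge0//.
by rewrite gerBl.
Qed.

Lemma msd_ge0 t : (0 <= msd f t)%E.
Proof.
by apply: integral_ge0 => y yt; rewrite lee_fin msd_dens_ge0.
Qed.

Lemma msd_fin (t : R) : 0 <= t -> msd f t \is a fin_num.
Proof.
move=> t0; rewrite ge0_fin_numE ?msd_ge0//.
apply: (@le_lt_trans _ _ (\int[mu]_(y in `[0%R, t]) (2 * t * (tail f 0 + t))%:E)%E).
  apply: ge0_le_integral => //.
  - by move=> y yt; rewrite lee_fin msd_dens_ge0.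
  - by apply/measurable_EFinP; exact: measurable_msd_dens.
  - move=> y yt; rewrite lee_fin msd_dens_le//.
    by move: yt; rewrite /= in_itv/= => /andP[].
by rewrite integral_cst//= lebesgue_measure_itv/=; case: ifP => _; rewrite -?EFinB ?mule0 -?EFinM ltry.
Qed.

Hypothesis finf : (\int[mu]_(s in `[0%R, +oo[) (2 * s * f s)%:E = +oo)%E.

Lemma msd_superlinear (A : R) : \forall t \near +oo, ((A * (1 + t))%:E <= msd f t)%E.
Proof.
have mF (D : set R) : measurable_fun D (fun s : R => (2 * s * f s)%:E).
  apply/measurable_EFinP; apply: measurable_funM; last exact: measurable_funTS.
  exact: measurable_funM.
have H : (\int[mu]_(s in `[0%R, n%:R]) (2 * s * f s)%:E @[n --> \oo] --> +oo)%E.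
  rewrite -finf itv_bndy_bigcup_BRight.
  under [X in (_ --> \int[mu]_(x in X) _)%E]eq_bigcupr do rewrite add0r.
  apply: ge0_nondecreasing_set_cvg_integral => //.
  - move=> i j ij; apply/subsetPset => s /=; rewrite !in_itv/= => /andP[-> /le_trans]; apply.
    by rewrite ler_nat.
  - by move=> i; exact: mF.
  - by move=> i s; rewrite /= in_itv/= => /andP[s0 _]; rewrite lee_fin !mulr_ge0.
have [n Hn] : exists n : nat, ((4 * `|A|)%:E <= \int[mu]_(s in `[0%R, n%:R]) (2 * s * f s)%:E)%E.
  have /cvgeyPge/(_ (4 * `|A|)) [n _ Hn] := H.
  by exists n; apply: (Hn n) => /=.
near=> t.
have t1 : 1 <= t by near: t; exact: nbhs_pinfty_ge.
have tn : 2 * n%:R <= t by near: t; exact: nbhs_pinfty_ge.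
apply: (@le_trans _ _ ((t / 2)%:E * \int[mu]_(s in `[0%R, n%:R]) (2 * s * f s)%:E)%E).
  apply: (@le_trans _ _ ((t / 2)%:E * (4 * `|A|)%:E)%E).
    rewrite -EFinM lee_fin.
    have := ler_norm A; have := normr_ge0 A; nra.
  by rewrite lee_pmul2l// lte_fin divr_gt0// (lt_le_trans _ t1).
rewrite -ge0_integralZl_EFin//; last 3 first.
- move=> s; rewrite /= in_itv/= => /andP[s0 _]; rewrite lee_fin mulr_ge0//.
  by rewrite mulr_ge0.
- exact: mF.
- by rewrite divr_ge0// (le_trans _ t1).
have nt : n%:R <= t.
  by rewrite (le_trans _ tn)// ler_peMl// ler1n.
have sub : `[0, n%:R]%classic `<=` (`[0, t]%classic : set R).
  by move=> s /=; rewrite !in_itv/= => /andP[-> /le_trans]; apply.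
have md : measurable_fun (`[0, n%:R] : set R) (EFin \o msd_dens f t).
  by apply/measurable_EFinP; apply: measurable_funS sub _ => //; exact: measurable_msd_dens.
apply: (@le_trans _ _ (\int[mu]_(y in `[0%R, n%:R]) (msd_dens f t y)%:E)%E).
  apply: ge0_le_integral => //.
  - move=> s; rewrite /= in_itv/= => /andP[s0 _]; rewrite -EFinM lee_fin.
    by rewrite !mulr_ge0// (le_trans _ t1).
  - by apply: emeasurable_funM => //; exact: mF.
  - move=> s; rewrite /= in_itv/= => /andP[s0 sn]; rewrite -EFinM lee_fin.
    rewrite /msd_dens mulrCA ler_wpM2l ?mulr_ge0//.
    rewrite -[leLHS]add0r lerD ?tail_ge0// ler_wpM2r//.
    by lra.
apply: ge0_subset_integral => //=.
- by apply/measurable_EFinP; exact: measurable_msd_dens.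
- by move=> s; exact: msd_dens_ge0.
Unshelve. all: by end_near. Qed.

End one_tail.

Section two_tails.
Variables f g : R -> R.
Hypotheses (Sf : survival f) (Sg : survival g).

Lemma tail_domin (c s0 y : R) : 0 <= c -> 0 <= s0 ->
  (forall s, s0 <= s -> f s <= c * g s) -> s0 <= y -> tail f y <= c * tail g y.
Proof.
move=> c0 s00 fg sy.
have y0 := le_trans s00 sy.
have g0 x : 0 <= g x by case: Sg => _ /(_ x)/andP[].
have f0 x : 0 <= f x by case: Sf => _ /(_ x)/andP[].
have [mf _ _] := Sf; have [mg _ _] := Sg.
have mgE (D : set R) : measurable_fun D (EFin \o g).
  by apply/measurable_EFinP; apply: measurable_funTS.
have mfE (D : set R) : measurable_fun D (EFin \o f).
  by apply/measurable_EFinP; apply: measurable_funTS.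
rewrite -lee_fin EFinM -!tail_fin// -ge0_integralZl_EFin//.
- apply: ge0_le_integral => //.
  + by move=> s _; rewrite lee_fin.
  + exact: mfE.
  + by apply: emeasurable_funM => //; exact: mgE.
  + by move=> s; rewrite /= in_itv/= andbT => ys; rewrite -EFinM lee_fin fg// (le_trans sy).
- by move=> s _; rewrite lee_fin.
- exact: mgE.
Qed.

Lemma msd_domin (c s0 t : R) : 0 <= c -> 0 <= s0 -> s0 <= t ->
  (forall s, s0 <= s -> f s <= c * g s) ->
  (msd f t <= (2 * s0 ^+ 2 * (tail f 0 + t))%:E + c%:E * msd g t)%E.
Proof.
move=> c0 s00 st fg.
have t0 := le_trans s00 st.
have mdf : measurable_fun (`[0, t] : set R) (EFin \o msd_dens f t).
  by apply/measurable_EFinP; exact: measurable_msd_dens.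
have mdg : measurable_fun (`[0, t] : set R) (EFin \o msd_dens g t).
  by apply/measurable_EFinP; exact: measurable_msd_dens.
pose h y : \bar R := (2 * s0 * (tail f 0 + t) * (y <= s0)%R%:R)%:E.
have K0 : 0 <= 2 * s0 * (tail f 0 + t) by rewrite !mulr_ge0// addr_ge0// tail_ge0.
have mh : measurable_fun (`[0, t] : set R) h.
  apply/measurable_EFinP; apply: measurable_funM => //.
  by apply: measurable_bool_natmul; exact: measurable_fun_ler.
have ih : (\int[mu]_(y in `[0%R, t]) h y = (2 * s0 ^+ 2 * (tail f 0 + t))%:E)%E.
  rewrite /h; under eq_integral do rewrite EFinM.
  rewrite ge0_integralZl_EFin//; last first.
    apply/measurable_EFinP; apply: measurable_bool_natmul; exact: measurable_fun_ler.
  transitivity ((2 * s0 * (tail f 0 + t))%:E * \int[mu]_(y in `[0%R, t]) (\1_(`]-oo, s0]%classic) y)%:E)%E.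
    congr (_ * _)%E; apply: eq_integral => y _.
    by rewrite indicE mem_setE in_itv/=.
  rewrite integral_indic// (_ : _ `&` _ = `[0, s0]%classic); last first.
    apply/seteqP; split => y /=; rewrite !in_itv/=.
      by move=> [ys /andP[-> _]].
    by move=> /andP[-> ys]; rewrite ys (le_trans ys st).
  rewrite [X in (_ * X)%E](lebesgue_measure_itv `[0, s0])/= lte_fin; case: ltP => s0'.
    by rewrite sube0 -EFinM; congr EFin; ring.
  have -> : s0 = 0 by apply/eqP; rewrite eq_le s0' s00.
  by rewrite mule0; congr EFin; ring.
rewrite /msd -ih -ge0_integralZl_EFin//; last by move=> y yt; rewrite lee_fin msd_dens_ge0.
rewrite -ge0_integralD//; last 3 first.
- by move=> y _; rewrite lee_fin mulr_ge0.
- by move=> y yt; rewrite -EFinM lee_fin mulr_ge0// msd_dens_ge0.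
- exact: emeasurable_funM.
apply: ge0_le_integral => //.
- by move=> y yt; rewrite lee_fin msd_dens_ge0.
- by apply: emeasurable_funD => //; exact: emeasurable_funM.
move=> y yt; rewrite /h -EFinM -EFinD lee_fin.
have dg : 0 <= c * msd_dens g t y by rewrite mulr_ge0// msd_dens_ge0.
have [ys|ys] := leP y s0.
  by rewrite mulr1 -[leLHS]addr0 lerD// msd_dens_le.
rewrite mulr0 add0r /msd_dens mulrCA.
move: yt; rewrite /= in_itv/= => /andP[y0 yt].
rewrite ler_wpM2l ?mulr_ge0// mulrDr lerD//.
  exact: tail_domin (ltW ys).
by rewrite mulrCA ler_wpM2l ?subr_ge0// fg// ltW.
Qed.

End two_tails.
End tails.

Section msd_asymptotics.
Context (R : realType).
Implicit Types f g : R -> R.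

Lemma equiv_le_near f g (e : R) : 0 < e -> (forall x, 0 <= f x) ->
  (forall x, 0 <= g x) ->
  f t / g t @[t --> +oo] --> (1 : R) -> \forall t \near +oo, f t <= (1 + e) * g t.
Proof.
move=> e0 f0 g0 fg.
have d0 : 0 < Num.min e (1 / 2) by rewrite lt_min e0 divr_gt0.
near=> t.
have : `|1 - f t / g t| < Num.min e (1 / 2).
  by near: t; move/cvgrPdist_lt : fg; apply.
rewrite lt_min => /andP[H1 H2].
have [gt0|gN0] := eqVneq (g t) 0.
  by move: H2; rewrite gt0 invr0 mulr0 subr0 normr1; lra.
have gp : 0 < g t by rewrite lt_neqAle eq_sym gN0 g0.
rewrite -ler_pdivrMr//; move: H1; rewrite ltr_norml => /andP[H1 _]; lra.
Unshelve. all: by end_near. Qed.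

Lemma msd_le_near f g (e : R) : 0 < e -> survival f -> survival g ->
  (\int[@lebesgue_measure R]_(s in `[0%R, +oo[) (2 * s * g s)%:E = +oo)%E ->
  (\forall t \near +oo, f t <= (1 + e / 2) * g t) ->
  \forall t \near +oo, fine (msd f t) <= (1 + e) * fine (msd g t).
Proof.
move=> e0 Sf Sg goo [s1 [_ fg]].
set s0 := Num.max 0 (s1 + 1).
have s00 : 0 <= s0 by rewrite le_max lexx.
have fg' s : s0 <= s -> f s <= (1 + e / 2) * g s.
  move=> s0s; apply: fg; apply: lt_le_trans s0s.
  by rewrite lt_max ltrDl ltr01 orbT.
pose A := 4 / e * s0 ^+ 2 * (1 + tail f 0).
have t0f := tail_ge0 Sf 0.
near=> t.
have st : s0 <= t by near: t; apply: nbhs_pinfty_ge; rewrite num_real.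
have t0 := le_trans s00 st.
have H1 : ((A * (1 + t))%:E <= msd g t)%E.
  by near: t; exact: msd_superlinear.
have c0 : 0 <= 1 + e / 2 by rewrite addr_ge0// divr_ge0// ltW.
have := msd_domin Sf Sg c0 s00 st fg'.
move: H1; rewrite -(fineK (msd_fin Sf t0)) -(fineK (msd_fin Sg t0)) -EFinM -EFinD !lee_fin/=.
set Ng := fine (msd g t); set Nf := fine (msd f t) => H1 H2.
apply: le_trans H2 _.
have : 2 * s0 ^+ 2 * (tail f 0 + t) <= e / 2 * (A * (1 + t)).
  have -> : e / 2 * (A * (1 + t)) = 2 * s0 ^+ 2 * ((1 + tail f 0) * (1 + t)).
    by rewrite /A; field; rewrite gt_eqF.
  rewrite ler_wpM2l ?mulr_ge0 ?exprn_ge0//; nra.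
have : e / 2 * (A * (1 + t)) <= e / 2 * Ng by rewrite ler_wpM2l// divr_ge0// ltW.
lra.
Unshelve. all: by end_near. Qed.

Lemma msd_equiv f g : survival f -> survival g ->
  (\int[@lebesgue_measure R]_(s in `[0%R, +oo[) (2 * s * f s)%:E = +oo)%E ->
  (\int[@lebesgue_measure R]_(s in `[0%R, +oo[) (2 * s * g s)%:E = +oo)%E ->
  f t / g t @[t --> +oo] --> (1 : R) ->
  fine (msd f t) / fine (msd g t) @[t --> +oo] --> (1 : R).
Proof.
move=> Sf Sg foo goo fg.
have f0 x : 0 <= f x by case: Sf => _ /(_ x)/andP[].
have g0 x : 0 <= g x by case: Sg => _ /(_ x)/andP[].
have gf : g t / f t @[t --> +oo] --> (1 : R).
  rewrite -invr1; under eq_fun do rewrite -invf_div.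
  by apply: cvgV => //; exact: oner_neq0.
apply/cvgrPdist_le => e e0.
have e20 : 0 < e / 2 by rewrite divr_gt0.
near=> t.
have t0 : 0 <= t by near: t; exact: nbhs_pinfty_ge.
have H1 : fine (msd f t) <= (1 + e) * fine (msd g t).
  by near: t; apply: msd_le_near => //; exact: equiv_le_near.
have H2 : fine (msd g t) <= (1 + e) * fine (msd f t).
  by near: t; apply: msd_le_near => //; exact: equiv_le_near.
have Ng0 : 1 <= fine (msd g t).
  have : ((1 * (1 + t))%:E <= msd g t)%E by near: t; exact: msd_superlinear.
  rewrite -(fineK (msd_fin Sg t0)) lee_fin; lra.
have Ngp : 0 < fine (msd g t) by exact: lt_le_trans Ng0.
set r := _ / _.
have r1 : r <= 1 + e by rewrite /r ler_pdivrMr.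
have r2 : 1 <= (1 + e) * r by rewrite /r mulrA ler_pdivlMr// mul1r.
rewrite ler_norml; nra.
Unshelve. all: by end_near. Qed.

End msd_asymptotics.

(** * The equilibrium renewal process *)

Section tonelli.
Local Open Scope ereal_scope.
Context (R : realType) (d : measure_display) (T : measurableType d).
Variable P : probability T R.
Local Notation mu := (@lebesgue_measure R).

Lemma tonelli_on (D : set R) (h : T * R -> \bar R) : measurable D ->
  measurable_fun setT h -> (forall z, 0 <= h z) ->
  \int[P]_w \int[mu]_(u in D) h (w, u) = \int[mu]_(u in D) \int[P]_w h (w, u).
Proof.
move=> mD mh h0.
transitivity (\int[P]_w \int[mu]_u (h (w, u) * (\1_D u)%:E)).
  apply: eq_integral => w _; rewrite [LHS]integral_mkcond; apply: eq_integral => u _.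
  by rewrite patchE indicE; case: ifP => _; rewrite ?mule1 ?mule0.
rewrite (fubini_tonelli (fun z : T * measurableTypeR R => h z * (\1_D z.2)%:E))/=.
- rewrite [RHS]integral_mkcond; apply: eq_integral => u _.
  rewrite patchE indicE; case: ifP => _.
    by apply: eq_integral => w _; rewrite mule1.
  by apply: integral0_eq => w _; rewrite mule0.
- apply: emeasurable_funM => //.
  apply/measurable_EFinP; apply: (measurableT_comp _ measurable_snd).
  exact: measurable_indic.
- by move=> z; rewrite mule_ge0// lee_fin.
Qed.

Lemma integral_bool (b : T -> bool) : measurable_fun setT b ->
  \int[P]_w (b w)%:R%:E = P [set w | b w].
Proof.
move=> mb; transitivity (\int[P]_w (\1_[set w | b w] w)%:E).
  by apply: eq_integral => w _; rewrite indicE; congr (_%:R%:E); rewrite mem_setE.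
rewrite integral_indic ?setIT//.
by have := mb measurableT [set true] Logic.I; rewrite setTI.
Qed.

Lemma null_bigcup (A : (set T)^nat) : (forall n, measurable (A n)) ->
  (forall n, P (A n) = 0) -> P (\bigcup_n A n) = 0.
Proof.
move=> mA A0; apply/eqP; rewrite -measure_le0.
apply: (@le_trans _ _ (\sum_(0 <= n <oo) P (A n))).
  by apply: measure_sigma_subadditive => //; exact: bigcup_measurable.
by rewrite eseries0.
Qed.

Lemma sume_cst (c : \bar R) n : 0 <= c -> \sum_(0 <= i < n) c = n%:R%:E * c.
Proof.
move=> c0; elim: n => [|n IH]; first by rewrite big_geq// mul0e.
by rewrite big_nat_recr//= IH -natr1 EFinD ge0_muleDl ?mul1e// lee_fin.
Qed.

End tonelli.

Section renewal_times.
Context (R : realType) (T : Type).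
Variables (X0 : T -> R) (X : nat -> T -> R).

Definition arrival (n : nat) (w : T) : R := X0 w + \sum_(i < n) X i.+1 w.

Definition duration (i : nat) : T -> R := if i is 0 then X0 else X i.

Definition start (i : nat) (w : T) : R := if i is j.+1 then arrival j w else 0.

(* The length of [[0, t] `&` [start i, start i + duration i[], provided that
   [start i] and [duration i] are nonnegative. *)
Definition sojourn (t : R) (i : nat) (w : T) : R :=
  Num.max 0 (Num.min t (Num.min (duration i w) (t - start i w))).

End renewal_times.

Section measurable_renewal_times.
Context (R : realType) (d : measure_display) (T : measurableType d).
Variables (X0 : T -> R) (X : nat -> T -> R).
Hypotheses (mX0 : measurable_fun setT X0) (mX : forall i, measurable_fun setT (X i.+1)).

Lemma measurable_arrival n : measurable_fun setT (arrival X0 X n).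
Proof. by apply: measurable_funD => //; apply: measurable_sum => i. Qed.

Lemma measurable_duration i : measurable_fun setT (duration X0 X i).
Proof. by case: i. Qed.

Lemma measurable_start i : measurable_fun setT (start X0 X i).
Proof. by case: i => [|i]; [exact: measurable_cst|exact: measurable_arrival]. Qed.

Lemma measurable_sojourn t i : measurable_fun setT (sojourn X0 X t i).
Proof.
apply: measurable_maxr => //; apply: measurable_minr => //; apply: measurable_minr.
  exact: measurable_duration.
by apply: measurable_funB => //; exact: measurable_start.
Qed.

End measurable_renewal_times.

Section sojourn_length.
Context (R : realType).
Local Notation mu := (@lebesgue_measure R).

Lemma lebesgue_measure_sojourn (a b t : R) : 0 <= a -> 0 < b -> 0 <= t ->
  mu (`[a, a + b[%classic `&` `[0, t]%classic) =
  (Num.max 0 (Num.min t (Num.min b (t - a))))%:E.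
Proof.
move=> a0 b0 t0; have [abt|tab] := leP (a + b) t.
  rewrite (_ : _ `&` _ = `[a, a + b[%classic); last first.
    apply/seteqP; split => x /=; rewrite !in_itv/=; first by case.
    move=> /andP[ax xb]; rewrite ax xb; split=> //.
    by rewrite (le_trans a0 ax)/= (le_trans (ltW xb)).
  rewrite [LHS](lebesgue_measure_itv `[a, a + b[)/= lte_fin ltrDl b0 -EFinB; congr EFin.
  rewrite (min_l (x := b)); last lra.
  by rewrite min_r ?max_r; lra.
rewrite (_ : _ `&` _ = `[a, t]%classic); last first.
  apply/seteqP; split => x /=; rewrite !in_itv/=.
    by move=> [/andP[-> _] /andP[_ ->]].
  move=> /andP[ax xt]; rewrite ax xt andbT; split; first exact: le_lt_trans tab.
  by rewrite (le_trans a0 ax).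
rewrite [LHS](lebesgue_measure_itv `[a, t])/= lte_fin.
rewrite (min_r (x := b)); last lra.
rewrite min_r; last lra.
have [at0|ta] := ltP a t; rewrite -?EFinB; congr EFin; first by rewrite max_r; lra.
by rewrite max_l; lra.
Qed.

End sojourn_length.

Section same_law.
Local Open Scope ereal_scope.
Context (R : realType) (d : measure_display) (T : measurableType d).
Variables (P : probability T R) (f g : T -> R).
Hypotheses (mf : measurable_fun setT f) (mg : measurable_fun setT g).
Hypothesis fg : forall A, measurable A -> P (f @^-1` A) = P (g @^-1` A).

Lemma same_law_ge0_integral (h : R -> \bar R) : measurable_fun setT h ->
  (forall x, 0 <= h x) -> \int[P]_w h (f w) = \int[P]_w h (g w).
Proof.
move=> mh h0.
pose f' : {RV P >-> R} := mfun_Sub (mem_set mf).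
pose g' : {RV P >-> R} := mfun_Sub (mem_set mg).
transitivity (\int[distribution P f']_y h y); first by rewrite ge0_integral_distribution.
transitivity (\int[distribution P g']_y h y); last by rewrite ge0_integral_distribution.
by apply: eq_measure_integral => A mA _; exact: fg.
Qed.

Lemma same_law_integrable : P.-integrable setT (EFin \o g) -> P.-integrable setT (EFin \o f).
Proof.
move=> /integrableP[_ gi]; apply/integrableP; split; first exact/measurable_EFinP.
rewrite (same_law_ge0_integral (h := fun x => `|x%:E|))//.
by apply: measurableT_comp => //; exact/measurable_EFinP.
Qed.

Lemma same_law_integral : P.-integrable setT (EFin \o g) ->
  \int[P]_w (f w)%:E = \int[P]_w (g w)%:E.
Proof.
move=> gi; have fi := same_law_integrable gi.
pose f' : {RV P >-> R} := mfun_Sub (mem_set mf).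
pose g' : {RV P >-> R} := mfun_Sub (mem_set mg).
have mE : measurable_fun setT (@EFin R) by exact/measurable_EFinP.
transitivity (\int[distribution P f']_y y%:E); first by rewrite integral_distribution.
transitivity (\int[distribution P g']_y y%:E); last by rewrite integral_distribution.
by apply: eq_measure_integral => A mA _; exact: fg.
Qed.

End same_law.

Section path.
Context (R : realType) (d : measure_display) (Om : measurableType d).
Variables (T0 : Om -> R) (tau : nat -> Om -> R) (w : Om).
Local Notation mu := (@lebesgue_measure R).

Lemma TnE n : Tn T0 tau n w = arrival T0 tau n w.
Proof.
elim: n => [|n IH] /=; first by rewrite /arrival big_ord0 addr0.
by rewrite IH /arrival big_ord_recr/= addrA.
Qed.

Lemma TloE n : Tlo T0 tau n w = start T0 tau n w.
Proof. by case: n => //= n; exact: TnE. Qed.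

Lemma arrivalE n : arrival T0 tau n w = start T0 tau n w + duration T0 tau n w.
Proof.
by case: n => [|n]; rewrite /arrival ?big_ord0 ?addr0 ?add0r//= big_ord_recr/= addrA.
Qed.

Hypothesis dur0 : forall i, 0 < duration T0 tau i w.

Lemma arrival_le m n : (m <= n)%N -> arrival T0 tau m w <= arrival T0 tau n w.
Proof.
elim: n => [|n IH]; first by rewrite leqn0 => /eqP ->.
rewrite leq_eqVlt => /predU1P[->//|/IH /le_trans]; apply.
by rewrite [leRHS]arrivalE lerDl ltW.
Qed.

Lemma start_ge0 n : 0 <= start T0 tau n w.
Proof.
case: n => //= n; apply: le_trans (arrival_le (leq0n n)).
by rewrite arrivalE/= add0r ltW//; exact: (dur0 0).
Qed.

Lemma sojourn_eq0 t n i : 0 <= t -> t < arrival T0 tau n w -> (n < i)%N -> sojourn T0 tau t i w = 0.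
Proof.
move=> t0 tn; case: i => // i ni; rewrite /sojourn max_l// ge_min ge_min.
by rewrite /= subr_le0 (ltW (lt_le_trans tn (arrival_le _))) ?orbT.
Qed.

Lemma visit_unique s i j : start T0 tau i w <= s < arrival T0 tau i w ->
  start T0 tau j w <= s < arrival T0 tau j w -> i = j.
Proof.
wlog ij : i j / (i <= j)%N.
  by move=> H hi hj; case/orP: (leq_total i j) => ij; [exact: H|apply/esym; exact: H].
move=> /andP[_ si] /andP[sj _]; move: ij; rewrite leq_eqVlt => /predU1P[//|].
case: j sj => //= j sj ij.
by have := lt_le_trans si (le_trans (arrival_le (ij : (i <= j)%N)) sj); rewrite ltxx.
Qed.

Variables (dim : nat) (V : nat -> 'I_dim -> Om -> R).

Lemma vel_sum n s k : 0 <= s -> s < arrival T0 tau n w ->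
  vel T0 tau V s w k = \sum_(i < n.+1) V i k w * \1_(`[start T0 tau i w, arrival T0 tau i w[%classic) s.
Proof.
move=> s0 sn; rewrite /vel.
have [i0 i0n hi0] : exists2 i0 : 'I_n.+1, (i0 <= n)%N & start T0 tau i0 w <= s < arrival T0 tau i0 w.
  have ex : exists i, s < arrival T0 tau i w by exists n.
  case: (ex_minnP ex) => i si mini.
  have i_n : (i < n.+1)%N by rewrite ltnS mini.
  exists (Ordinal i_n) => //=; rewrite si andbT.
  case: i si mini i_n => //= i si mini _.
  by rewrite leNgt; apply/negP => /mini; rewrite ltnn.
case: pselect => [H|]; last first.
  by move=> []; exists i0; rewrite TloE TnE.
case: cid => j /=; rewrite TloE TnE => hj.
rewrite (bigD1 i0)//= indicE mem_set ?mulr1; last by rewrite /= in_itv.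
rewrite big1 ?addr0; first by rewrite (visit_unique hj hi0).
move=> i ii0; rewrite indicE memNset ?mulr0//= in_itv/= => hi.
by move/eqP: ii0; apply; apply: val_inj => /=; exact: visit_unique hi hi0.
Qed.

Lemma Xpos_sum n t k : 0 <= t -> t < arrival T0 tau n w ->
  Xpos T0 tau V t w k = \sum_(i < n.+1) V i k w * sojourn T0 tau t i w.
Proof.
move=> t0 tn; rewrite /Xpos /Rintegral.
have E : {in (`[0%R, t]%classic : set R), forall s, (vel T0 tau V s w k)%:E =
   (\sum_(i < n.+1) (V i k w)%:E * (\1_(`[start T0 tau i w, arrival T0 tau i w[%classic) s)%:E)%E}.
  move=> s; rewrite inE/= in_itv/= => /andP[s0 st].
  rewrite (vel_sum (n := n))//; last exact: le_lt_trans tn.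
  by rewrite -sumEFin; apply: eq_bigr => i _; rewrite EFinM.
have int1 i : mu.-integrable `[0%R, t] (fun s => (\1_(`[start T0 tau i w, arrival T0 tau i w[%classic) s)%:E).
  apply: (integrableS measurableT) => //.
  exact: integrable_indic_itv.
rewrite (_ : integral _ _ _ = (\sum_(i < n.+1) (V i k w * sojourn T0 tau t i w)%:E)%E).
  by rewrite sumEFin.
transitivity (\int[mu]_(s in `[0%R, t])
   (\sum_(i < n.+1) (V i k w)%:E * (\1_(`[start T0 tau i w, arrival T0 tau i w[%classic) s)%:E))%E.
  exact: eq_integral.
rewrite integral_sum//; last by move=> i; exact: integrableZl.
apply: eq_bigr => i _; rewrite integralZl// integral_indic// EFinM; congr (_ * _)%E.
rewrite arrivalE; apply: lebesgue_measure_sojourn => //; exact: start_ge0.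
Qed.

End path.

Section process.
Context (R : realType) (d : measure_display) (Om : measurableType d).
Variables (P : probability Om R) (dim : nat) (F : R -> R) (T0 : Om -> R).
Variables (tau : nat -> Om -> R) (V : nat -> 'I_dim -> Om -> R) (v : R).
Hypothesis hS : eq_setup P F T0 tau V v.
Hypotheses (hFc : continuous F) (hF0 : F 0 = 0).
Hypothesis hFm : (\int[@lebesgue_measure R]_(s in `[0%R, +oo[) (1 - F s)%:E < +oo)%E.
Local Notation mu := (@lebesgue_measure R).

Let f (s : R) : R := 1 - F s.
Let S n w := \sum_(i < n) tau i.+1 w.
Local Notation dur := (duration T0 tau).
Let src (j : nat + nat) : set (set Om) := match j with
  | inl 0 => sigma_RV T0 | inl i => sigma_RV (tau i) | inr i => sigma_RVvec (V i) end.

Let mT0 : measurable_fun setT T0. Proof. by case: hS. Qed.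
Let mtau i : measurable_fun setT (tau i). Proof. by case: hS => _ []. Qed.
Let mV i k : measurable_fun setT (V i k). Proof. by case: hS => _ [_ []]. Qed.
Let src_ind : mutually_independent P src. Proof. by case: hS => _ [_ [_ []]]. Qed.
Let cdfT0 x : P [set w | T0 w <= x] = (F0 F x)%:E.
Proof. by case: hS => _ [_ [_ [_ []]]]. Qed.
Let cdftau i x : P [set w | tau i.+1 w <= x] = (F x)%:E.
Proof. by case: hS => _ [_ [_ [_ [_ [h _]]]]]; exact: h. Qed.

Let mdur i : measurable_fun setT (dur i).
Proof. exact: measurable_duration. Qed.

Let src_alg j : sigma_algebra setT (src j).
Proof. by case: j => [[|i]|i]; exact: smallest_sigma_algebra. Qed.

Let src_meas j : src j `<=` measurable.
Proof.
case: j => [[|i]|i]; apply: smallest_sub; try exact: sigma_algebra_measurable.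
- by move=> _ [B mB <-]; exact: mT0.
- by move=> _ [B mB <-]; exact: mtau.
- by move=> _ [k _ [B mB <-]]; exact: mV.
Qed.

Let src_dur i A : measurable A -> src (inl i) (dur i @^-1` A).
Proof.
by move=> mA; case: i => [|i]; apply: sub_sigma_algebra; exists A => //; rewrite setTI.
Qed.

Let src_V i k A : measurable A -> src (inr i) (V i k @^-1` A).
Proof.
move=> mA; apply: sub_sigma_algebra; exists k => //.
by exists A => //; rewrite setTI.
Qed.

Lemma survival_cdf : survival f.
Proof.
split => //.
- apply: measurable_funB => //; apply: continuous_measurable_fun.
  exact: hFc.
- move=> x; have Px : (0 <= (F x)%:E <= 1)%E.
    by rewrite -(cdftau 0) measure_ge0 probability_le1// -[X in measurable X]setTI; apply: measurable_fun_le.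
  by move: Px; rewrite !lee_fin /f => /andP[? ?]; apply/andP; split; lra.
Qed.

Let mf := survival_cdf.

Let tb := taubar F.

Let tbE : tb = tail f 0. Proof. by []. Qed.

Let mle (X : Om -> R) x : measurable_fun setT X -> measurable [set w | X w <= x].
Proof.
move=> mX; rewrite (_ : [set _ | _] = X @^-1` `]-oo, x]%classic).
  by rewrite -[X in measurable X]setTI; exact: mX.
by apply/seteqP; split => w /=; rewrite in_itv.
Qed.

Let mlt (X : Om -> R) x : measurable_fun setT X -> measurable [set w | x < X w].
Proof.
move=> mX; rewrite (_ : [set _ | _] = X @^-1` `]x, +oo[%classic).
  by rewrite -[X in measurable X]setTI; exact: mX.
by apply/seteqP; split => w /=; rewrite in_itv/= andbT.
Qed.

Lemma ex_F0_gt0 : exists a, 0 < F0 F a.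
Proof.
apply: contrapT => /forallNP N.
have N' n : P [set w | T0 w <= n%:R] = 0%E.
  apply/eqP; rewrite eq_le measure_ge0 andbT cdfT0 lee_fin leNgt.
  exact/negP/N.
have : P setT = 0%E.
  rewrite (_ : setT = \bigcup_n [set w | T0 w <= n%:R]).
    by apply: null_bigcup => n //; exact: mle.
  apply/seteqP; split => w //= _; exists (Num.truncn (T0 w)).+1 => //=.
  by rewrite ltW// truncnS_gt.
by rewrite probability_setT => /eqP; rewrite onee_eq0.
Qed.

Lemma taubar_gt0 : 0 < tb.
Proof.
have [a F0a] := ex_F0_gt0; rewrite lt_neqAle tbE (tail_ge0 mf) andbT.
apply/eqP => tb0; move: F0a;
  by rewrite /F0 -/tb tbE -tb0 invr0 mul0r ltxx.
Qed.

Lemma taubarM_F0 x : 0 <= x -> tb * F0 F x = tb - tail f x.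
Proof.
move=> x0; rewrite /F0 -/tb mulrA mulfV ?mul1r; last by rewrite gt_eqF ?taubar_gt0.
have := tail_split mf x0; rewrite -tbE /Rintegral.
set I := (X in _ = (X + _)%E -> _) => H.
rewrite -/(f) -/I.
have : I \is a fin_num.
  rewrite ge0_fin_numE; last by apply: integral_ge0 => s _; rewrite lee_fin; case: mf => _ /(_ s)/andP[].
  apply: (@le_lt_trans _ _ (I + (tail f x)%:E)%E); last by rewrite -H ltry.
  by rewrite leeDl// lee_fin tail_ge0.
by move: H => /[swap] /fineK <- /= [->]; rewrite addrK.
Qed.

Lemma F0_le0 x : x <= 0 -> F0 F x = 0.
Proof.
rewrite le_eqVlt => /predU1P[->|x0]; rewrite /F0.
  by rewrite set_itv1 /Rintegral integral_set1 mulr0.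
by rewrite set_itv_ge ?bnd_simp -?ltNge// /Rintegral integral_set0 mulr0.
Qed.

Lemma ae_dur_gt0 i : P [set w | dur i w <= 0] = 0%E.
Proof. by case: i => [|i]; rewrite ?cdfT0 ?cdftau ?F0_le0 ?hF0. Qed.

Lemma ccdf_tau i y : P [set w | y < tau i.+1 w] = (f y)%:E.
Proof.
rewrite (_ : [set _ | _] = ~` [set w | tau i.+1 w <= y]).
  by rewrite probability_setC ?cdftau//; exact: mle.
by apply/seteqP; split => w /=; rewrite ltNge => /negP.
Qed.

Lemma ccdf_T0 y : 0 <= y -> P [set w | y < T0 w] = (tail f y / tb)%:E.
Proof.
move=> y0; rewrite (_ : [set _ | _] = ~` [set w | T0 w <= y]).
  rewrite probability_setC ?cdfT0//; last exact: mle.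
  rewrite -EFinB; congr EFin.
  have tb0 : tb != 0 by rewrite gt_eqF ?taubar_gt0.
  apply: (mulfI tb0); rewrite mulrBr taubarM_F0// mulr1 mulrCA mulfV//; ring.
by apply/seteqP; split => w /=; rewrite ltNge => /negP.
Qed.

Let mS n : measurable_fun setT (S n).
Proof. by apply: measurable_sum => i. Qed.

Let marrival n : measurable_fun setT (arrival T0 tau n).
Proof. exact: measurable_arrival. Qed.

Lemma indep_dur_S i n : (i = 0 \/ n < i)%N -> indep_pair P (dur i) (S n).
Proof.
move=> hi; apply: (@indep_pair_family_but _ _ _ P _ src src_alg src_meas src_ind (inl i)).
  exact: src_dur.
apply: measurable_sum => j.
apply: (@measurable_family_but _ _ _ _ _ (inl i) (inl j.+1)).
  apply/eqP => -[ji]; case: hi => [i0|]; first by rewrite i0 in ji.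
  by rewrite -ji ltnNge ltn_ord.
exact: (@src_dur j.+1).
Qed.

Lemma indep_dur_arrival i n : (n < i)%N -> indep_pair P (dur i) (arrival T0 tau n).
Proof.
move=> hi; apply: (@indep_pair_family_but _ _ _ P _ src src_alg src_meas src_ind (inl i)).
  exact: src_dur.
apply: measurable_funD.
  apply: (@measurable_family_but _ _ _ _ _ (inl i) (inl 0%N)); last exact: (@src_dur 0).
  by apply/eqP => -[i0]; rewrite -i0 in hi.
apply: measurable_sum => j.
apply: (@measurable_family_but _ _ _ _ _ (inl i) (inl j.+1)); last exact: (@src_dur j.+1).
apply/eqP => -[ji].
by move: hi; rewrite -ji ltnNge ltn_ord.
Qed.

Lemma integral_pospart_tau i z :
  (\int[P]_w (Num.max 0 (z - tau i.+1 w))%:E = \int[mu]_(u in `[0%R, z]) (F u)%:E)%E.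
Proof.
transitivity (\int[P]_w \int[mu]_(u in `[0%R, z]) ((tau i.+1 w <= u)%R%:R)%:E)%E.
  apply/esym/(ge0_integral_eq_conull (G := [set w | 0 < tau i.+1 w])).
  - exact: mlt.
  - rewrite (_ : ~` _ = [set w | tau i.+1 w <= 0]); first exact: (ae_dur_gt0 i.+1).
    by apply/seteqP; split => w /=; rewrite leNgt => /negP.
  - apply/measurable_EFinP; apply: measurable_maxr => //.
    exact: measurable_funB.
  - by move=> w; apply: integral_ge0 => u _; rewrite lee_fin.
  - by move=> w; rewrite lee_fin le_max lexx.
  - by move=> w; rewrite inE/= => t0; rewrite integral_layer_pospart// ltW.
rewrite (tonelli_on P (h := fun z => ((tau i.+1 z.1 <= z.2)%R%:R)%:E))//.
- apply: eq_integral => u _; rewrite integral_bool ?cdftau//.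
  exact: measurable_fun_ler.
- apply/measurable_EFinP; apply: measurable_bool_natmul; apply: measurable_fun_ler => //.
  exact: measurableT_comp.
Qed.

Let excess n x := (\int[P]_w (Num.max 0 (x - S n w))%:E)%E.

Let mmax0 (h : Om -> R) : measurable_fun setT h -> measurable_fun setT (fun w => Num.max 0 (h w)).
Proof. by move=> mh; exact: measurable_maxr. Qed.

Lemma pospart_split z : (tb%:E * (F0 F z)%:E + \int[mu]_(u in `[0%R, z]) (F u)%:E =
  (Num.max 0 z)%:E)%E.
Proof.
have [z0|z0] := leP 0 z; last first.
  rewrite (F0_le0 (ltW z0)) mule0 add0e.
  by rewrite set_itv_ge ?bnd_simp -?ltNge// integral_set0.
rewrite -EFinM taubarM_F0// EFinB tbE (tail_split mf z0) addeK//.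
have F0' u : 0 <= F u by case: mf => _ /(_ u)/andP[_]; rewrite /f; lra.
rewrite -ge0_integralD//.
- under eq_integral do rewrite -EFinD subrK.
  by rewrite integral_cst// mul1e [LHS](lebesgue_measure_itv `[0, z])/= lte_fin;
    case: ltP => // z0'; rewrite ?sube0//; congr EFin; apply/eqP; rewrite eq_le z0 z0'.
- by move=> u _; rewrite lee_fin; case: mf => _ /(_ u)/andP[].
- by apply/measurable_EFinP; apply: measurable_funTS; case: mf.
- by move=> u _; rewrite lee_fin.
- by apply/measurable_EFinP; apply: measurable_funTS; apply: continuous_measurable_fun.
Qed.

Lemma measurable_F0 : measurable_fun setT (F0 F).
Proof.
apply: nondecreasing_measurable => // x y xy.
rewrite -lee_fin -!cdfT0; apply: le_measure; rewrite ?inE; [exact: mle..|].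
by move=> w /= /le_trans; apply.
Qed.

Let Tle n (x : R) : set Om := [set w | arrival T0 tau n w <= x].

Let mTle n x : measurable (Tle n x). Proof. exact: mle. Qed.

(* The function [fun x => max 0 x / taubar] solves the renewal equation, by
   [pospart_split]; conditioning on [S n] iterates it. *)
Lemma renewal_step n x : (excess n x = tb%:E * P (Tle n x) + excess n.+1 x)%E.
Proof.
have F00 z : 0 <= F0 F z by rewrite -lee_fin -cdfT0.
have mF0S : measurable_fun setT (fun w => F0 F (x - S n w)).
  by apply: measurableT_comp; [exact: measurable_F0|exact: measurable_funB].
have -> : P (Tle n x) = (\int[P]_w (F0 F (x - S n w))%:E)%E.
  rewrite -integral_bool; last exact: measurable_fun_ler.
  rewrite (indep_pair_integral mT0 (mS n) (@indep_dur_S 0 n (or_introl erefl))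
    (h := fun z => ((z.1 + z.2 <= x)%R%:R)%:E))//.
    apply: eq_integral => w _ /=; rewrite integral_bool.
      rewrite -cdfT0; congr (P _); apply/seteqP; split => w' /=; lra.
    by apply: measurable_fun_ler => //; exact: measurable_funD.
  apply/measurable_EFinP; apply: measurable_bool_natmul; apply: measurable_fun_ler => //.
  exact: measurable_funD.
pose phi w : \bar R := (\int[mu]_(u in `[0%R, (x - S n w)%R]) (F u)%:E)%E.
have -> : excess n.+1 x = (\int[P]_w phi w)%E.
  rewrite /excess.
  under eq_integral do rewrite /S big_ord_recr/= opprD addrA -/(S _ _).
  rewrite (indep_pair_integral (mtau n.+1) (mS n) (@indep_dur_S n.+1 n (or_intror (ltnSn n)))
    (h := fun z => (Num.max 0 (x - z.2 - z.1))%:E))//.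
  - by apply: eq_integral => w _ /=; rewrite integral_pospart_tau.
  - apply/measurable_EFinP; apply: measurable_maxr => //.
    by apply: measurable_funB => //; exact: measurable_funB.
  - by move=> z; rewrite lee_fin le_max lexx.
have phi0 w : (0 <= phi w)%E.
  by apply: integral_ge0 => u _; rewrite lee_fin; case: mf => _ /(_ u)/andP[_]; rewrite /f; lra.
have phiE w : phi w = (Num.max 0 (x - S n w) - tb * F0 F (x - S n w))%:E.
  by rewrite EFinB -pospart_split -/(phi w) -EFinM [X in (X - _)%E]addeC addeK.
rewrite -ge0_integralZl_EFin//; last 3 first.
- by move=> w _; rewrite lee_fin.
- exact/measurable_EFinP.
- exact/ltW/taubar_gt0.
rewrite -ge0_integralD//; last 3 first.
- by move=> w _; rewrite -EFinM lee_fin mulr_ge0// ltW// taubar_gt0.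
- by apply: emeasurable_funM => //; exact/measurable_EFinP.
- rewrite (funext phiE).
  apply/measurable_EFinP; apply: measurable_funB; last exact: measurable_funM.
  by apply: mmax0; exact: measurable_funB.
by apply: eq_integral => w _; rewrite pospart_split.
Qed.

Lemma renewal_sum n x : (excess 0 x = tb%:E * (\sum_(0 <= i < n) P (Tle i x)) + excess n x)%E.
Proof.
elim: n => [|n IH]; first by rewrite big_geq// mule0 add0e.
rewrite IH renewal_step addeA big_nat_recr//= ge0_muleDr//.
by apply: sume_ge0.
Qed.

Lemma excess0E x : excess 0 x = (Num.max 0 x)%:E.
Proof.
rewrite /excess; under eq_integral do rewrite /S big_ord0 subr0.
by rewrite integral_cst//= probability_setT mule1.
Qed.

Lemma excess_ge0 n x : (0 <= excess n x)%E.
Proof. by apply: integral_ge0 => w _; rewrite lee_fin le_max lexx. Qed.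

Lemma cdf_arrival_mono n x : (P (Tle n.+1 x) <= P (Tle n x))%E.
Proof.
have mN : measurable [set w | tau n.+1 w <= 0] by exact: mle.
rewrite (measureDI P (mTle n.+1 x) mN) [X in (_ + X)%E](_ : _ = 0%E) ?adde0.
  apply: le_measure; rewrite ?inE//; first exact: measurableD.
  move=> w [] /=; rewrite /Tle /= /arrival big_ord_recr/= => H /negP; rewrite -ltNge => t0.
  by lra.
apply/eqP; rewrite -measure_le0 -(ae_dur_gt0 n.+1).
by apply: le_measure; rewrite ?inE//; exact: measurableI.
Qed.

Lemma cdf_arrival_le n x : n%:R * (tb * fine (P (Tle n x))) <= Num.max 0 x.
Proof.
rewrite -lee_fin !EFinM (fineK (fin_num_measure P _ (mTle n x))).
rewrite -excess0E (renewal_sum n) -[leLHS]adde0 leeD ?excess_ge0//.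
rewrite muleCA lee_pmul2l ?lte_fin ?taubar_gt0//.
have mono i : (i <= n)%N -> (P (Tle n x) <= P (Tle i x))%E.
  elim: n => [|m IH]; first by rewrite leqn0 => /eqP ->.
  rewrite leq_eqVlt => /predU1P[->//|/IH]; apply: le_trans; exact: cdf_arrival_mono.
apply: (@le_trans _ _ (\sum_(0 <= i < n) P (Tle n x))%E).
  by rewrite sume_cst.
by rewrite !big_mkord; apply: lee_sum => i _; apply: mono; exact: ltnW.
Qed.

Lemma S_ge0_conull n : exists N, [/\ measurable N, P N = 0%E & forall w, ~ N w -> 0 <= S n w].
Proof.
exists (\bigcup_i [set w | dur i w <= 0]); split.
- by apply: bigcup_measurable => i _; exact: mle.
- by apply: null_bigcup => i; [exact: mle|exact: ae_dur_gt0].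
- move=> w Nw; apply: sumr_ge0 => i _; rewrite leNgt; apply/negP => ti.
  by apply: Nw; exists i.+1 => //=; exact: ltW.
Qed.

Lemma excess_le n x : 0 <= x -> (excess n x <= x%:E * P [set w | S n w <= x]%R)%E.
Proof.
move=> x0; have [N [mN N0 HN]] := S_ge0_conull n.
rewrite -integral_bool; last exact: measurable_fun_ler.
rewrite -ge0_integralZl_EFin//; last first.
  by apply/measurable_EFinP; apply: measurable_bool_natmul; exact: measurable_fun_ler.
apply: ae_ge0_le_integral => //.
- by move=> w _; rewrite lee_fin le_max lexx.
- by apply/measurable_EFinP; apply: mmax0; exact: measurable_funB.
- by move=> w _; rewrite -EFinM lee_fin mulr_ge0.
- apply: emeasurable_funM => //.
  by apply/measurable_EFinP; apply: measurable_bool_natmul; exact: measurable_fun_ler.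
- exists N; split => // w /= H; apply: contrapT => Nw; apply: H => _.
  rewrite -EFinM lee_fin; have := HN w Nw.
  by case: (leP (S n w) x) => Sx; rewrite ?mulr1 ?mulr0 ge_max; lra.
Qed.

(* [S n] cannot stay below [x] with a probability bounded away from 0, since
   [T0] is independent of it and [n * P (T_n <= x + a)] is bounded. *)
Lemma excess_small x : 0 <= x -> forall eps : R, 0 < eps -> exists n, (excess n x <= eps%:E)%E.
Proof.
move=> x0 eps eps0; have [a F0a] := ex_F0_gt0.
pose K := x * Num.max 0 (x + a); pose c := tb * F0 F a * eps.
have c0 : 0 < c by rewrite /c; apply: mulr_gt0 => //; apply: mulr_gt0 => //; exact: taubar_gt0.
exists (Num.truncn (K / c)).+1; set n := _.+1.
apply: (le_trans (excess_le n x0)).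
have qp : (P [set w | S n w <= x]%R * (F0 F a)%:E <= P (Tle n (x + a)%R))%E.
  rewrite -cdfT0 muleC -[X in (X * _)%E](_ : P (dur 0 @^-1` `]-oo, a]%classic) = _); last first.
    by congr (P _); apply/seteqP; split => w /=; rewrite in_itv.
  rewrite -[X in (_ * X)%E](_ : P (S n @^-1` `]-oo, x]%classic) = _); last first.
    by congr (P _); apply/seteqP; split => w /=; rewrite in_itv.
  rewrite -(@indep_dur_S 0 n (or_introl erefl))//; apply: le_measure; rewrite ?inE//.
    by apply: measurableI; rewrite -[X in measurable X]setTI; [exact: mT0|exact: mS].
  move=> w [] /=; rewrite !in_itv/= => T0a Sx.
  by rewrite /Tle /= /arrival -/(S n w) addrC lerD.
have := cdf_arrival_le n (x + a); move: qp.
rewrite -(fineK (fin_num_measure P _ (mle x (mS n)))) -(fineK (fin_num_measure P _ (mTle n (x + a)))).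
set q := fine _; set p := fine _; rewrite -!EFinM !lee_fin => qp H.
have nK : K / c < n%:R by rewrite /n truncnS_gt.
have q0 : 0 <= q by exact: fine_ge0.
have tb0 := taubar_gt0.
move: nK; rewrite ltr_pdivrMr// => nK.
have n0 : (0 : R) < n%:R by rewrite ltr0n.
rewrite -(ler_pM2l (mulr_gt0 n0 (mulr_gt0 tb0 F0a))).
apply: (@le_trans _ _ (x * (n%:R * (tb * p)))).
  rewrite [leLHS](_ : _ = (x * n%:R * tb) * (q * F0 F a)); last by ring.
  rewrite [leRHS](_ : _ = (x * n%:R * tb) * p); last by ring.
  by rewrite ler_wpM2l// !mulr_ge0// ltW.
apply: (@le_trans _ _ K); first by rewrite ler_wpM2l.
by rewrite ltW// (lt_le_trans nK)// /c; lra.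
Qed.

Lemma renewal_series x : 0 <= x -> (tb%:E * \sum_(0 <= i <oo) P (Tle i x) = x%:E)%E.
Proof.
move=> x0.
have tb0 := taubar_gt0.
have xE n : (x%:E = tb%:E * (\sum_(0 <= i < n) P (Tle i x)) + excess n x)%E.
  by rewrite -renewal_sum excess0E max_r.
apply/eqP; rewrite eq_le; apply/andP; split.
- rewrite -nneseriesZl//; apply: lime_le; first by apply: is_cvg_nneseries => i _ _; rewrite mule_ge0// lee_fin ltW.
  apply: nearW => n; rewrite (xE n) ge0_sume_distrr//.
  by rewrite leeDl ?excess_ge0.
- apply/lee_addgt0Pr => eps eps0.
  have [n en] := excess_small x0 eps0.
  rewrite (xE n) leeD// lee_pmul2l ?lte_fin//.
  exact: nneseries_lim_ge.
Qed.

Let bad : set Om := (\bigcup_i [set w | dur i w <= 0]) `|` (\bigcup_m \bigcap_n Tle n m%:R).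
Let good : set Om := ~` bad.

Let mbad : measurable bad.
Proof.
apply: measurableU; first by apply: bigcup_measurable => i _; exact: mle.
by apply: bigcup_measurable => m _; exact: bigcapT_measurable.
Qed.

Let mgood : measurable good. Proof. exact: measurableC. Qed.

Lemma bad_null : P bad = 0%E.
Proof.
apply/eqP; rewrite -measure_le0.
pose A i := if odd i then [set w | dur i./2 w <= 0] else \bigcap_n Tle n (i./2)%:R.
have mA i : measurable (A i).
  by rewrite /A; case: ifP => _; [exact: mle|exact: bigcapT_measurable].
have A0 i : P (A i) = 0%E.
  rewrite /A; case: ifP => _; first exact: ae_dur_gt0.
  set x := (i./2)%:R.
  have pn n : n%:R * (tb * fine (P (\bigcap_n Tle n x))) <= x.
    rewrite -[leRHS](max_r (ler0n _ _)); apply: le_trans (cdf_arrival_le n x).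
    rewrite ler_wpM2l// ler_wpM2l ?(ltW taubar_gt0)// fine_le ?fin_num_measure//.
      exact: bigcapT_measurable.
    apply: le_measure; rewrite ?inE//; first exact: bigcapT_measurable.
    exact: bigcap_inf.
  have : 0 <= fine (P (\bigcap_n Tle n x)) by exact: fine_ge0.
  rewrite le_eqVlt => /predU1P[p0|p0].
    by rewrite -[LHS]fineK -?p0// fin_num_measure//; exact: bigcapT_measurable.
  have c0 := mulr_gt0 taubar_gt0 p0.
  have := pn (Num.truncn (x / (tb * fine (P (\bigcap_n Tle n x))))).+1.
  by rewrite -ler_pdivlMr// leNgt truncnS_gt.
rewrite -(null_bigcup mA A0); apply: le_measure; rewrite ?inE//; first exact: bigcup_measurable.
move=> w [[i _ wi]|[m _ wm]].
  by exists (i.*2.+1) => //; rewrite /A /= odd_double/= uphalf_double.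
by exists m.*2 => //; rewrite /A odd_double doubleK.
Qed.

Let goodN : P (~` good) = 0%E. Proof. by rewrite /good setCK bad_null. Qed.

Local Notation lo := (start T0 tau).
Local Notation L := (sojourn T0 tau).

Let mlo i : measurable_fun setT (lo i). Proof. exact: measurable_start. Qed.

Let mL t i : measurable_fun setT (L t i). Proof. exact: measurable_sojourn. Qed.

Lemma integral_sojourn_sqr t i : 0 <= t ->
  (\int[P]_w (L t i w ^+ 2)%:E = \int[mu]_(y in `[0%R, t]) ((2 * y)%:E *
     P [set w | ((y < dur i w) && (lo i w <= t - y))%R]))%E.
Proof.
move=> t0.
have mb (y : R) : measurable_fun setT (fun w => (y < dur i w) && (lo i w <= t - y)).
  by apply: measurable_and; [exact: measurable_fun_ltr|exact: measurable_fun_ler].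
transitivity (\int[P]_w \int[mu]_(y in `[0%R, t])
   (2 * Num.max 0 y * ((y < dur i w) && (lo i w <= t - y))%R%:R)%:E)%E.
  apply: eq_integral => w _; rewrite -integral_layer_sqr//; apply: eq_integral => y.
  by rewrite inE/= in_itv/= => /andP[y0 _]; rewrite max_r.
rewrite (tonelli_on P (h := fun z : Om * R => (2 * Num.max 0 z.2 *
  ((z.2 < dur i z.1) && (lo i z.1 <= t - z.2))%R%:R)%:E))//.
- apply: eq_integral => y; rewrite inE/= in_itv/= => /andP[y0 _].
  rewrite max_r//; under eq_integral do rewrite EFinM.
  rewrite ge0_integralZl_EFin//; last 2 first.
  + by apply/measurable_EFinP; exact: measurable_bool_natmul.
  + by rewrite mulr_ge0.
  by rewrite integral_bool.
- apply/measurable_EFinP; apply: measurable_funM.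
    by apply: measurable_funM => //; exact: measurable_maxr.
  apply: measurable_bool_natmul; apply: measurable_and.
    by apply: measurable_fun_ltr => //; exact: measurableT_comp.
  apply: measurable_fun_ler; first exact: measurableT_comp.
  exact: measurable_funB.
- by move=> z; rewrite lee_fin !mulr_ge0// le_max lexx.
Qed.

Lemma integral_sojourn_sqr0 t : 0 <= t -> (tb%:E * \int[P]_w (L t 0 w ^+ 2)%:E =
  \int[mu]_(y in `[0%R, t]) (2 * y * tail f y)%:E)%E.
Proof.
move=> t0; rewrite integral_sojourn_sqr//.
have mt : measurable_fun (`[0%R, t] : set R) (fun y => (2 * y * tail f y)%:E).
  apply/measurable_EFinP; apply: measurable_funM; first exact: measurable_funM.
  exact: measurable_tail.
have E y : y \in (`[0%R, t]%classic : set R) ->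
    ((2 * y)%:E * P [set w | ((y < dur 0 w) && (lo 0 w <= t - y))%R] =
     tb^-1%:E * (2 * y * tail f y)%:E)%E.
  rewrite inE/= in_itv/= => /andP[y0 yt].
  rewrite (_ : [set w | _] = [set w | y < T0 w]); last first.
    by apply/seteqP; split => w /=; rewrite subr_ge0 yt andbT.
  by rewrite ccdf_T0// -!EFinM; congr EFin; ring.
transitivity (tb%:E * \int[mu]_(y in `[0%R, t]) (tb^-1%:E * (2 * y * tail f y)%:E))%E.
  by congr (_ * _)%E; exact: eq_integral.
rewrite ge0_integralZl_EFin//; last 2 first.
- move=> y; rewrite /= in_itv/= => /andP[y0 _].
  by rewrite lee_fin !mulr_ge0// tail_ge0.
- by rewrite invr_ge0 ltW// taubar_gt0.
by rewrite muleA -EFinM mulfV ?mul1e// gt_eqF// taubar_gt0.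
Qed.

Lemma integral_sojourn_sqrS t i : 0 <= t -> (\int[P]_w (L t i.+1 w ^+ 2)%:E =
  \int[mu]_(y in `[0%R, t]) ((2 * y * f y)%:E * P (Tle i (t - y)%R)))%E.
Proof.
move=> t0; rewrite integral_sojourn_sqr//; apply: eq_integral => y _.
have -> : P [set w | ((y < dur i.+1 w) && (lo i.+1 w <= t - y))%R] =
   ((f y)%:E * P (Tle i (t - y)%R))%E.
  rewrite -(ccdf_tau i) -[X in (X * _)%E](_ : P (dur i.+1 @^-1` `]y, +oo[%classic) = _); last first.
    by congr (P _); apply/seteqP; split => w /=; rewrite in_itv/= andbT.
  rewrite -[X in (_ * X)%E](_ : P (arrival T0 tau i @^-1` `]-oo, t - y]%classic) = _); last first.
    by congr (P _); apply/seteqP; split => w /=; rewrite in_itv.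
  rewrite -(@indep_dur_arrival i.+1 i (ltnSn i))//; congr (P _).
  by apply/seteqP; split => w /=; rewrite !in_itv/= andbT; [move/andP|move/andP].
by rewrite muleA -EFinM.
Qed.

Lemma sum_integral_sojourn_sqr t : 0 <= t ->
  (tb%:E * \sum_(0 <= i <oo) \int[P]_w (L t i w ^+ 2)%:E = msd f t)%E.
Proof.
move=> t0; have tb0 := taubar_gt0.
have f0 y : 0 <= f y by case: mf => _ /(_ y)/andP[].
have m2 (D : set R) : measurable_fun D (fun y : R => 2 * y * f y).
  apply: measurable_funM; first exact: measurable_funM.
  by apply: measurable_funTS; case: mf.
have L20 i : (0 <= \int[P]_w (L t i w ^+ 2)%:E)%E.
  by apply: integral_ge0 => w _; rewrite lee_fin sqr_ge0.
have mPT i : measurable_fun (`[0%R, t] : set R) (fun y => P (Tle i (t - y)%R)).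
  apply: (eq_measurable_fun (EFin \o (fun y : R => fine (P (Tle i (t - y)%R))))).
    by move=> y _ /=; rewrite fineK// fin_num_measure.
  apply/measurable_EFinP; apply: nonincreasing_measurable => // x y xy.
  rewrite fine_le ?fin_num_measure//; apply: le_measure; rewrite ?inE//.
  by move=> w; rewrite /Tle /= => /le_trans; apply; rewrite lerB.
rewrite nneseries_recl// ge0_muleDr//; last by apply: nneseries_ge0.
rewrite integral_sojourn_sqr0//.
have -> : (\sum_(1 <= k <oo) \int[P]_w (L t k w ^+ 2)%:E =
   \sum_(0 <= k <oo) \int[P]_w (L t k.+1 w ^+ 2)%:E)%E.
  rewrite -(@nneseries_addn _ _ 1 L20).
  by apply: eq_eseriesr => k _; rewrite addn1.
under eq_eseriesr => i _ do rewrite integral_sojourn_sqrS//.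
have m2E : measurable_fun (`[0%R, t] : set R) (fun y => (2 * y * f y)%:E).
  by apply/measurable_EFinP; exact: m2.
have m20 y : `[0%R, t]%classic y -> (0 <= (2 * y * f y)%:E)%E.
  by rewrite /= in_itv/= => /andP[y0 _]; rewrite lee_fin !mulr_ge0.
rewrite -integral_nneseries//; last 2 first.
- by move=> i; apply: emeasurable_funM; [exact: m2E|exact: mPT].
- by move=> i y yt; rewrite mule_ge0// m20.
rewrite -ge0_integralZl_EFin//; last 3 first.
- by move=> y yt; apply: nneseries_ge0 => i _ _; rewrite mule_ge0// m20.
- apply: ge0_emeasurable_sum => //.
  + by move=> i y yt _; rewrite mule_ge0// m20.
  + by move=> i _; apply: emeasurable_funM; [exact: m2E|exact: mPT].
- exact: ltW.
have E y : y \in (`[0%R, t]%classic : set R) ->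
   (tb%:E * \sum_(0 <= i <oo) ((2 * y * f y)%:E * P (Tle i (t - y)%R)) =
    (2 * y * f y * (t - y))%:E)%E.
  rewrite inE/= in_itv/= => /andP[y0 yt].
  by rewrite nneseriesZl// muleCA renewal_series ?subr_ge0// -EFinM.
rewrite [X in (_ + X)%E](_ : _ = \int[mu]_(y in `[0%R, t]) (2 * y * f y * (t - y))%:E)%E;
  last exact: eq_integral.
rewrite -ge0_integralD//.
- apply: eq_integral => y _; rewrite -EFinD /msd_dens; congr EFin; ring.
- move=> y; rewrite /= in_itv/= => /andP[y0 _].
  by rewrite lee_fin !mulr_ge0// tail_ge0.
- apply/measurable_EFinP; apply: measurable_funM; first exact: measurable_funM.
  exact: measurable_tail.
- move=> y; rewrite /= in_itv/= => /andP[y0 yt].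
  by rewrite lee_fin !mulr_ge0// subr_ge0.
- apply/measurable_EFinP; apply: measurable_funM; first exact: m2.
  exact: measurable_funB.
Qed.

(** * The mean square displacement *)

Lemma good_dur_gt0 w : good w -> forall i, 0 < dur i w.
Proof.
move=> gw i; rewrite ltNge; apply/negP => di; apply: gw; left.
by exists i.
Qed.

Lemma good_exceeds w (t : R) : good w -> exists n, t < arrival T0 tau n w.
Proof.
move=> gw; apply: contrapT => /forallNP N; apply: gw; right.
exists (Num.truncn t).+1 => // n _; rewrite /Tle /=.
have /negP := N n; rewrite -leNgt => /le_trans; apply.
by rewrite ltW// truncnS_gt.
Qed.

(* Truncating to [t < T_n] leaves finitely many sojourns, and keeps the
   truncation a function of the times alone. *)
Lemma cvg_integral_arrival_gt t (W : Om -> \bar R) (Wn : nat -> Om -> \bar R) :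
  (forall w, 0 <= W w)%E -> (forall n w, 0 <= Wn n w)%E ->
  (forall n, measurable_fun setT (Wn n)) ->
  (forall n w, good w -> Wn n w = if t < arrival T0 tau n w then W w else 0%E) ->
  (\int[P]_w Wn n w @[n --> \oo] --> \int[P]_w W w)%E.
Proof.
move=> W0 Wn0 mWn WnE.
have cvgW w : good w -> (Wn n w @[n --> \oo] --> W w)%E.
  move=> gw; have [N tN] := good_exceeds t gw.
  apply: cvg_near_cst; exists N => // n /= Nn; rewrite WnE//.
  by rewrite (lt_le_trans tN (arrival_le (good_dur_gt0 gw) Nn)).
have mW : measurable_fun good W.
  by apply: (emeasurable_fun_cvg Wn) => // n; exact: measurable_funTS.
rewrite (ge0_integral_conull mgood goodN mW W0).
under eq_fun do rewrite (ge0_integral_conull mgood goodN (measurable_funTS (mWn _)) (Wn0 _)).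
rewrite (_ : (\int[P]_(x in good) W x = \int[P]_(x in good) limn (Wn ^~ x))%E); last first.
  by apply: eq_integral => w; rewrite inE => gw; apply/esym/cvg_lim => //; exact: cvgW.
apply: cvg_monotone_convergence => //.
- by move=> n; exact: measurable_funTS.
- move=> w gw m n mn; rewrite !WnE//.
  case: ifPn => // tm; case: ifPn => //.
  by rewrite (lt_le_trans tm (arrival_le (good_dur_gt0 gw) mn)).
Qed.

Section truncated.
Variables (t : R) (n : nat).
Hypothesis t0 : 0 <= t.

Let La i w : R := L t i w * (t < arrival T0 tau n w)%R%:R.

Let La0 i w : 0 <= La i w. Proof. by rewrite mulr_ge0// le_max lexx. Qed.

Let Lat i w : La i w <= t.
Proof.
rewrite -[leRHS]mulr1 ler_pM// ?le_max ?lexx//; last by rewrite lern1 leq_b1.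
by rewrite ge_max t0 ge_min lexx.
Qed.

Let mLa_rest j i : measurable_fun [set: g_sigma_algebraType (family_but src (inr j))] (La i).
Proof.
have m0 : measurable_fun [set: g_sigma_algebraType (family_but src (inr j))] T0.
  exact: (@measurable_family_but _ _ _ _ _ (inr j) (inl 0%N) _ _ (@src_dur 0)).
have mt i' : measurable_fun [set: g_sigma_algebraType (family_but src (inr j))] (tau i'.+1).
  exact: (@measurable_family_but _ _ _ _ _ (inr j) (inl i'.+1) _ _ (@src_dur i'.+1)).
apply: measurable_funM; first exact: (measurable_sojourn m0 mt).
apply: measurable_bool_natmul; apply: measurable_fun_ltr => //.
exact: (measurable_arrival m0 mt).
Qed.

Let mLa i : measurable_fun setT (La i).
Proof. exact: (family_but_measurable src_meas (@mLa_rest 0 i)). Qed.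

Section component.
Variable k : 'I_dim.

Let Y m w : R := \sum_(i < m) V i k w * La i w.

Let law i A : measurable A -> P (V i k @^-1` A) = P (V 0%N k @^-1` A).
Proof.
move=> mA; case: hS => _ [_ [_ [_ [_ [_ [hV _]]]]]].
have := hV i (fun j => if j == k then A else setT).
have E i' : \big[setI/setT]_(j < dim) (V i' j @^-1` (if j == k then A else setT)) = V i' k @^-1` A.
  rewrite (bigD1 k)//= eqxx big1 ?setIT// => j /negPf ->.
  by rewrite preimage_setT.
by rewrite !E; apply => j; case: ifP.
Qed.

Let V0i : P.-integrable setT (EFin \o V 0%N k).
Proof. by case: hS => _ [_ [_ [_ [_ [_ [_ [/(_ k)[]]]]]]]]. Qed.

Let Vi i : P.-integrable setT (EFin \o V i k).
Proof. exact: (same_law_integrable (mV i k) (mV 0%N k) (@law i) V0i). Qed.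

Let V_mean i : (\int[P]_w (V i k w)%:E = 0)%E.
Proof.
rewrite (same_law_integral (mV i k) (mV 0%N k) (@law i) V0i).
by case: hS => _ [_ [_ [_ [_ [_ [_ [/(_ k)[]]]]]]]].
Qed.

Let c := (\int[P]_w ((V 0%N k w) ^+ 2)%:E)%E.

Let V_sqr i : (\int[P]_w ((V i k w) ^+ 2)%:E = c)%E.
Proof.
apply: (same_law_ge0_integral (mV i k) (mV 0%N k) (@law i) (h := fun x => (x ^+ 2)%:E)).
  by apply/measurable_EFinP; exact: measurable_funX.
by move=> x; rewrite lee_fin sqr_ge0.
Qed.

Let c_fin : (c < +oo)%E.
Proof.
apply: (@le_lt_trans _ _ (v ^+ 2)%:E); last exact: ltry.
case: hS => _ [_ [_ [_ [_ [_ [_ [_ <-]]]]]]].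
apply: ge0_le_integral => //.
- by move=> w _; rewrite lee_fin sqr_ge0.
- by apply/measurable_EFinP; exact: measurable_funX.
- by apply/measurable_EFinP; apply: measurable_sum => j; exact: measurable_funX.
- move=> w _; rewrite lee_fin (bigD1 k)//= lerDl.
  by apply: sumr_ge0 => j _; exact: sqr_ge0.
Qed.

Let mY_rest j m : (m <= j)%N -> measurable_fun [set: g_sigma_algebraType (family_but src (inr j))] (Y m).
Proof.
move=> mj; apply: measurable_sum => i; apply: measurable_funM; last exact: mLa_rest.
apply: (@measurable_family_but _ _ _ _ _ (inr j) (inr (i : nat)) _ _ (@src_V i k)).
by apply/eqP => -[ij]; have := ltn_ord i; rewrite ltnNge ij mj.
Qed.

Let mY m : measurable_fun setT (Y m).
Proof. exact: (family_but_measurable src_meas (@mY_rest m m (leqnn m))). Qed.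

Let indV j g : measurable_fun [set: g_sigma_algebraType (family_but src (inr j))] g ->
  indep_pair P (V j k) g.
Proof.
move=> mg; apply: (@indep_pair_family_but _ _ _ P _ src src_alg src_meas src_ind (inr j)) => //.
exact: src_V.
Qed.

Let La2_fin i : (\int[P]_w (La i w ^+ 2)%:E < +oo)%E.
Proof.
apply: (@le_lt_trans _ _ (\int[P]_w (t ^+ 2)%:E)%E).
  apply: ge0_le_integral => //.
  - by move=> w _; rewrite lee_fin sqr_ge0.
  - by apply/measurable_EFinP; exact: measurable_funX.
  - by move=> w _; rewrite lee_fin lerXn2r ?nnegrE ?Lat.
have -> : (\int[P]_w (t ^+ 2)%:E = (t ^+ 2)%:E)%E.
  by rewrite integral_cst//= probability_setT mule1.
exact: ltry.
Qed.

Let VLa_sqr i : (\int[P]_w ((V i k w * La i w) ^+ 2)%:E = c * \int[P]_w (La i w ^+ 2)%:E)%E.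
Proof.
under eq_integral do rewrite exprMn.
rewrite (@indep_ge0_integralM _ _ _ P (fun w => V i k w ^+ 2) (fun w => La i w ^+ 2)).
- by rewrite V_sqr.
- exact: measurable_funX.
- exact: measurable_funX.
- have m2 : measurable_fun setT (fun x : R => x ^+ 2) by exact: measurable_funX.
  exact: (indep_pair_comp (indV (@mLa_rest i i)) m2 m2).
- by move=> w; exact: sqr_ge0.
- by move=> w; exact: sqr_ge0.
Qed.

Lemma truncated_second_moment m : P.-integrable setT (fun w => (Y m w ^+ 2)%:E) /\
  (\int[P]_w (Y m w ^+ 2)%:E = c * \sum_(i < m) \int[P]_w (La i w ^+ 2)%:E)%E.
Proof.
have c0 : (0 <= c)%E by apply: integral_ge0 => w _; rewrite lee_fin sqr_ge0.
elim: m => [|m [IHi IH]].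
  rewrite /Y; split.
    under eq_fun do rewrite big_ord0 expr0n/=.
    exact: integrable0.
  under eq_integral do rewrite big_ord0 expr0n/=.
  by rewrite big_ord0 mule0 integral0.
pose g w := Y m w * La m w.
have mg : measurable_fun [set: g_sigma_algebraType (family_but src (inr m))] g.
  by apply: measurable_funM; [exact: mY_rest|exact: mLa_rest].
have gi : P.-integrable setT (EFin \o g).
  apply: (@le_integrable _ _ _ P setT measurableT _ (fun w => (t%:E * (1 + (Y m w ^+ 2)%:E))%E)).
  - by apply/measurable_EFinP; exact: (family_but_measurable src_meas mg).
  - move=> w _; rewrite -EFinD -EFinM /= lee_fin /g normrM (ger0_norm (La0 _ _)).
    rewrite [leRHS]ger0_norm; last by rewrite mulr_ge0// addr_ge0// sqr_ge0.
    rewrite mulrC ler_pM// ?Lat// ler_norml.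
    have := sqr_ge0 (Y m w - 1); have := sqr_ge0 (Y m w + 1); nra.
  - apply: integrableZl => //; apply: integrableD => //.
    exact: finite_measure_integrable_cst.
have Vg0 := indep_integralM0 (indV mg) (Vi m) gi (V_mean m).
have Vgi := indep_integrableM (indV mg) (Vi m) gi.
have sqi : P.-integrable setT (fun w => ((V m k w * La m w) ^+ 2)%:E).
  apply/integrableP; split.
    by apply/measurable_EFinP; apply: measurable_funX; exact: measurable_funM.
  under eq_integral do rewrite gee0_abs ?lee_fin ?sqr_ge0//.
  by rewrite VLa_sqr lte_mul_pinfty ?ge0_fin_numE.
have YE w : (Y m.+1 w ^+ 2)%:E =
    ((Y m w ^+ 2)%:E + ((2%:E * (V m k w * g w)%:E) + ((V m k w * La m w) ^+ 2)%:E))%E.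
  by rewrite -EFinM -!EFinD /Y big_ord_recr/= -/(Y m w) /g; congr EFin; ring.
under eq_fun do rewrite YE.
have i2 : P.-integrable setT (fun w => 2%:E * (V m k w * g w)%:E)%E by exact: integrableZl.
have i3 : P.-integrable setT (fun w => 2%:E * (V m k w * g w)%:E + ((V m k w * La m w) ^+ 2)%:E)%E.
  exact: integrableD.
split; first exact: integrableD.
rewrite integralD// integralD// integralZl// Vg0 mule0 add0e IH VLa_sqr.
rewrite big_ord_recr/=; apply/esym/ge0_muleDr.
- by apply: sume_ge0 => i _; apply: integral_ge0 => w _; rewrite lee_fin sqr_ge0.
- by apply: integral_ge0 => w _; rewrite lee_fin sqr_ge0.
Qed.

End component.

Lemma truncated_msd m :
  (\int[P]_w (\sum_(k < dim) (\sum_(i < m) V i k w * La i w) ^+ 2)%:E =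
   (v ^+ 2)%:E * \int[P]_w (\sum_(i < m) La i w ^+ 2)%:E)%E.
Proof.
have mY k : measurable_fun setT (fun w => \sum_(i < m) V i k w * La i w).
  by apply: measurable_sum => i; exact: measurable_funM.
case: hS => _ [_ [_ [_ [_ [_ [_ [_ <-]]]]]]].
under eq_integral do rewrite -sumEFin.
rewrite ge0_integral_sum//; last 2 first.
- by move=> k; apply/measurable_EFinP; exact: measurable_funX.
- by move=> k w _; rewrite lee_fin sqr_ge0.
under eq_bigr => k _ do rewrite (truncated_second_moment k m).2.
under [in RHS]eq_integral do rewrite -sumEFin.
rewrite [X in (_ = X * _)%E]ge0_integral_sum//; last 2 first.
- by move=> k; apply/measurable_EFinP; exact: measurable_funX.
- by move=> k w _; rewrite lee_fin sqr_ge0.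
rewrite ge0_sume_distrl; last first.
  by move=> k _; apply: integral_ge0 => w _; rewrite lee_fin sqr_ge0.
apply: eq_bigr => k _; congr (_ * _)%E.
under [RHS]eq_integral do rewrite -sumEFin.
rewrite ge0_integral_sum//.
- by move=> i; apply/measurable_EFinP; exact: measurable_funX.
- by move=> i w _; rewrite lee_fin sqr_ge0.
Qed.

End truncated.

Lemma Meq_msd t : 0 <= t -> tb * Meq P T0 tau V t = v ^+ 2 * fine (msd f t).
Proof.
move=> t0.
pose La n i w : R := L t i w * (t < arrival T0 tau n w)%R%:R.
have mLa n i : measurable_fun setT (La n i).
  apply: measurable_funM => //; apply: measurable_bool_natmul.
  exact: measurable_fun_ltr.
have H1 := @cvg_integral_arrival_gt t (fun w => (\sum_(k < dim) (Xpos T0 tau V t w k) ^+ 2)%:E)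
  (fun n w => (\sum_(k < dim) (\sum_(i < n.+1) V i k w * La n i w) ^+ 2)%:E).
have H2 := @cvg_integral_arrival_gt t (fun w => (\sum_(0 <= i <oo) (L t i w ^+ 2)%:E)%E)
  (fun n w => (\sum_(i < n.+1) La n i w ^+ 2)%:E).
have {}H1 : (\int[P]_w (\sum_(k < dim) (\sum_(i < n.+1) V i k w * La n i w) ^+ 2)%:E
   @[n --> \oo] --> \int[P]_w (\sum_(k < dim) (Xpos T0 tau V t w k) ^+ 2)%:E)%E.
  apply: H1.
  - by move=> w; rewrite lee_fin sumr_ge0// => k _; exact: sqr_ge0.
  - by move=> n w; rewrite lee_fin sumr_ge0// => k _; exact: sqr_ge0.
  - move=> n; apply/measurable_EFinP; apply: measurable_sum => k; apply: measurable_funX.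
    by apply: measurable_sum => i; exact: measurable_funM.
  - move=> n w gw; case: ifPn => tn; last first.
      congr EFin; apply: big1 => k _; rewrite big1 ?expr0n// => i _.
      by rewrite /La (negbTE tn) !mulr0.
    congr EFin; apply: eq_bigr => k _; congr (_ ^+ 2).
    rewrite (Xpos_sum (good_dur_gt0 gw) V k t0 tn); apply: eq_bigr => i _.
    by rewrite /La tn mulr1.
have {}H2 : (\int[P]_w (\sum_(i < n.+1) La n i w ^+ 2)%:E
   @[n --> \oo] --> \int[P]_w \sum_(0 <= i <oo) (L t i w ^+ 2)%:E)%E.
  apply: H2.
  - by move=> w; apply: nneseries_ge0 => i _ _; rewrite lee_fin sqr_ge0.
  - by move=> n w; rewrite lee_fin sumr_ge0// => k _; exact: sqr_ge0.
  - move=> n; apply/measurable_EFinP; apply: measurable_sum => i; exact: measurable_funX.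
  - move=> n w gw; case: ifPn => tn; last first.
      by congr EFin; apply: big1 => i _; rewrite /La (negbTE tn) mulr0 expr0n.
    rewrite (nneseries_split _ n.+1); last by move=> i _; rewrite lee_fin sqr_ge0.
    rewrite add0n big_mkord eseries0 ?adde0.
      by rewrite -sumEFin; apply: eq_bigr => i _; rewrite /La tn mulr1.
    by move=> i ni _; rewrite (sojourn_eq0 (good_dur_gt0 gw) t0 tn ni) expr0n.
have E : (\int[P]_w (\sum_(k < dim) (Xpos T0 tau V t w k) ^+ 2)%:E =
   (v ^+ 2)%:E * \int[P]_w \sum_(0 <= i <oo) (L t i w ^+ 2)%:E)%E.
  apply: (cvg_unique _ H1) => //.
  have EE n : (\int[P]_w (\sum_(k < dim) (\sum_(i < n.+1) V i k w * La n i w) ^+ 2)%:E =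
      (v ^+ 2)%:E * \int[P]_w (\sum_(i < n.+1) La n i w ^+ 2)%:E)%E.
    exact: (@truncated_msd t n t0 n.+1).
  by rewrite /= (funext EE); exact: cvgeZl.
rewrite integral_nneseries in E; last 3 first.
- by [].
- by move=> i; apply/measurable_EFinP; exact: measurable_funX.
- by move=> i w _; rewrite lee_fin sqr_ge0.
rewrite /Meq E; have := sum_integral_sojourn_sqr t0.
set s := (\sum_(0 <= i <oo) _)%E => sE.
have tb0 := taubar_gt0.
have sfin : s \is a fin_num.
  have s0 : (0 <= s)%E by apply: nneseries_ge0 => i _ _; apply: integral_ge0 => w _; rewrite lee_fin sqr_ge0.
  have := msd_fin mf t0; rewrite -sE.
  case: s s0 {E sE} => //= _; by rewrite gt0_muley ?lte_fin.
by rewrite -sE -(fineK sfin) -!EFinM /= mulrCA.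
Qed.

End process.

Theorem theorem5p2 (R : realType) (F Ft : R -> R)
  (* F, Ft continuous distribution functions of positive random variables *)
  (hFc : continuous F) (hFtc : continuous Ft)
  (hF0 : F 0 = 0) (hFt0 : Ft 0 = 0)
  (* finite means *)
  (hFm : (\int[lebesgue_measure]_(s in `[0%R, +oo[) (1 - F s)%:E < +oo)%E)
  (hFtm : (\int[lebesgue_measure]_(s in `[0%R, +oo[) (1 - Ft s)%:E < +oo)%E)
  (* infinite variances *)
  (hFv : (\int[lebesgue_measure]_(s in `[0%R, +oo[) (2 * s * (1 - F s))%:E = +oo)%E)
  (hFtv : (\int[lebesgue_measure]_(s in `[0%R, +oo[) (2 * s * (1 - Ft s))%:E = +oo)%E)
  (* 1 - F(t) ~ 1 - Ft(t) as t -> oo *)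
  (hasym : (1 - F t) / (1 - Ft t) @[t --> +oo%R] --> (1:R))
  (dim : nat) (v : R) (hv : 0 < v)
  (* equilibrium setting for F *)
  (d1 : measure_display) (Omega1 : measurableType d1) (P1 : probability Omega1 R)
  (T0 : Omega1 -> R) (tau : nat -> Omega1 -> R) (V : nat -> 'I_dim -> Omega1 -> R)
  (hS : eq_setup P1 F T0 tau V v)
  (* equilibrium setting for Ft *)
  (d2 : measure_display) (Omega2 : measurableType d2) (P2 : probability Omega2 R)
  (Tt0 : Omega2 -> R) (taut : nat -> Omega2 -> R) (Vt : nat -> 'I_dim -> Omega2 -> R)
  (hSt : eq_setup P2 Ft Tt0 taut Vt v)
  (* same velocity distribution *)
  (hVlaw : forall B : 'I_dim -> set R, (forall k, measurable (B k)) ->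
     P1 (\big[setI/setT]_(k < dim) (V 0%N k @^-1` B k)) =
     P2 (\big[setI/setT]_(k < dim) (Vt 0%N k @^-1` B k))) :
  (taubar F * Meq P1 T0 tau V t) / (taubar Ft * Meq P2 Tt0 taut Vt t)
    @[t --> +oo%R] --> (1:R).
Proof.
have sv : survival (fun s => 1 - F s) by exact: survival_cdf hS hFc hFm.
have svt : survival (fun s => 1 - Ft s) by exact: survival_cdf hSt hFtc hFtm.
have := msd_equiv sv svt hFv hFtv hasym.
apply: cvg_trans; apply: near_eq_cvg; near=> t.
have t0 : 0 <= t by near: t; exact: nbhs_pinfty_ge.
rewrite (Meq_msd hS)// (Meq_msd hSt)// -mulf_div divff ?mul1r//.
by rewrite expf_neq0// gt_eqF.
Unshelve. all: by end_near. Qed.
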